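(* Let $\bar V_t$ be the post-decision value functions of the hydro reservoir problem defined in the context, with prices and inflows following the ARMA processes given there. Let $t\in\{1,\dots,T\}$, fix $\boldsymbol{\rho}_{[t]}\in\mathbb{R}^t$ and a point $(\bar{\mathbf{l}}_t^{n-1},\boldsymbol{\nu}_{[t]}^{n-1})$. Then $\bar V_t$ has a supporting hyperplane at this point: there are $\mathbf{a}_t\in\mathbb{R}^{|J|}$ and $\mathbf{b}_{[t]}\in\mathbb{R}^{t|J|}$ (a $t\times|J|$ matrix with entries $b_{js}$ in row $s$ and column $j$), whose entries $a_{jt}$ and $b_{js}$ ($j\in J$, $s=1,\dots,t$) are the components, with respect to $\bar l_{jt}$ and $\nu_{js}$, of a supergradient of $\bar V_t(\cdot,\cdot,\boldsymbol{\rho}_{[t]})$ at $(\bar{\mathbf{l}}_t^{n-1},\boldsymbol{\nu}_{[t]}^{n-1})$, such that the affine function $$\hat V_t(\bar{\mathbf{l}}_t,\boldsymbol{\nu}_{[t]},\boldsymbol{\rho}_{[t]})=\bar V_t(\bar{\mathbf{l}}_t^{n-1},\boldsymbol{\nu}_{[t]}^{n-1},\boldsymbol{\rho}_{[t]})+\mathbf{a}_t^T(\bar{\mathbf{l}}_t-\bar{\mathbf{l}}_t^{n-1})+\mathrm{Tr}\big(\mathbf{b}_{[t]}^T(\boldsymbol{\nu}_{[t]}-\boldsymbol{\nu}_{[t]}^{n-1})\big)$$ satisfies $$\hat V_t(\bar{\mathbf{l}}_t,\boldsymbol{\nu}_{[t]},\boldsymbol{\rho}_{[t]})\ge\bar V_t(\bar{\mathbf{l}}_t,\boldsymbol{\nu}_{[t]},\boldsymbol{\rho}_{[t]})\quad\text{for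 all }(\bar{\mathbf{l}}_t,\boldsymbol{\nu}_{[t]}),$$ and $\hat V_t(\bar{\mathbf{l}}_t^{n-1},\boldsymbol{\nu}_{[t]}^{n-1},\boldsymbol{\rho}_{[t]})=\bar V_t(\bar{\mathbf{l}}_t^{n-1},\boldsymbol{\nu}_{[t]}^{n-1},\boldsymbol{\rho}_{[t]})$.
   Context: Time periods are $t=1,\dots,T$; $J$ is a finite set of reservoirs arranged in a cascade, indexed by $j=1,\dots,|J|$. For each $t$: $\mathbf{l}_t\in\mathbb{R}^{|J|}$ are the storage levels at the beginning of period $t$; $\boldsymbol{\pi}_t\in\mathbb{R}^{|J|}$ are the discharges (decisions); $\boldsymbol{\nu}_t=(\nu_{1t},\dots,\nu_{|J|t})^T\in\mathbb{R}^{|J|}$ are random natural inflows; $\rho_t\in\mathbb{R}$ is the random electricity price. Histories: $\boldsymbol{\nu}_{j[t]}=(\nu_{j1},\dots,\nu_{jt})^T\in\mathbb{R}^t$, $\boldsymbol{\nu}_{[t]}=(\boldsymbol{\nu}_{1[t]},\dots,\boldsymbol{\nu}_{|J|[t]})\in\mathbb{R}^{t|J|}$ (a $t\times|J|$ matrix) and $\boldsymbol{\rho}_{[t]}=(\rho_1,\dots,\rho_t)^T\in\mathbb{R}^t$. The realizations of $\boldsymbol{\nu}_{[t]},\boldsymbol{\rho}_{[t]}$ are known when $\boldsymbol{\pi}_t$ is chosen. Given are bounds $\mathbf{l}^{min},\mathbf{l}^{max},\boldsymbol{\pi}^{min},\boldsymbol{\pi}^{max}\in\mathbb{R}^{|J|}$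 (all vector inequalities are componentwise), a vector $\mathbf{g}\in\mathbb{R}^{|J|}$ of conversion rates with $G(\mathbf{x})=\mathbf{g}^T\mathbf{x}$, and the matrix $R\in\mathbb{R}^{|J|\times|J|}$ with $R_{jj}=-1$, $R_{jk}=1$ for $k\in J^-(j)$, and $R_{jk}=0$ otherwise, where $J^-(j)$ is the set of reservoirs immediately upstream from $j$. Profit functions: $C_t(\boldsymbol{\pi}_t,\mathbf{l}_t,\boldsymbol{\nu}_{[t]},\boldsymbol{\rho}_{[t]})=\rho_t G(\boldsymbol{\pi}_t)$ for $t=1,\dots,T-1$, and $C_T(\boldsymbol{\pi}_T,\mathbf{l}_T,\boldsymbol{\nu}_{[T]},\boldsymbol{\rho}_{[T]})=\rho_T G(\boldsymbol{\pi}_T)+\mathbb{E}[\rho_{T+1}\mid\boldsymbol{\rho}_{[T]}]\,G(\mathbf{l}_{T+1})$ with $\mathbf{l}_{T+1}=\mathbf{l}_T+R\boldsymbol{\pi}_T+\boldsymbol{\nu}_T$. The post-decision reservoir level is $\bar{\mathbf{l}}_t=\mathbf{l}_t+R\boldsymbol{\pi}_t$, so that $\mathbf{l}_{t+1}=\bar{\mathbf{l}}_t+\boldsymbol{\nu}_t$. The feasible set is $$\Pi_{t+1}(\bar{\mathbf{l}}_t+\boldsymbol{\nu}_t,\boldsymbol{\nu}_{t+1})=\{\boldsymbol{\pi}_{t+1}:\ \bar{\mathbf{l}}_{t+1}=\bar{\mathbf{l}}_t+\boldsymbol{\nu}_t+R\boldsymbol{\pi}_{t+1},\ \mathbf{l}^{min}\le\bar{\mathbf{l}}_{t+1}+\boldsymbol{\nu}_{t+1}\le\mathbf{l}^{max},\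 \boldsymbol{\pi}^{min}\le\boldsymbol{\pi}_{t+1}\le\boldsymbol{\pi}^{max}\}.$$ The post-decision value functions are defined by backward recursion: $\bar V_T(\bar{\mathbf{l}}_T,\boldsymbol{\nu}_{[T]},\boldsymbol{\rho}_{[T]})=0$, and for $t<T$, $$\bar V_t(\bar{\mathbf{l}}_t,\boldsymbol{\nu}_{[t]},\boldsymbol{\rho}_{[t]})=\mathbb{E}\Big[\max_{\boldsymbol{\pi}_{t+1}\in\Pi_{t+1}(\bar{\mathbf{l}}_t+\boldsymbol{\nu}_t,\boldsymbol{\nu}_{t+1})}\Big\{C_{t+1}(\boldsymbol{\pi}_{t+1},\bar{\mathbf{l}}_t+\boldsymbol{\nu}_t,\boldsymbol{\nu}_{[t+1]},\boldsymbol{\rho}_{[t+1]})+\bar V_{t+1}(\bar{\mathbf{l}}_{t+1},\boldsymbol{\nu}_{[t+1]},\boldsymbol{\rho}_{[t+1]})\Big\}\,\Big|\,\boldsymbol{\nu}_{[t]},\boldsymbol{\rho}_{[t]}\Big],$$ where $\bar{\mathbf{l}}_{t+1}=\bar{\mathbf{l}}_t+\boldsymbol{\nu}_t+R\boldsymbol{\pi}_{t+1}$. Dynamics (ARMA): $\rho_{t+1}=\boldsymbol{\theta}_{[t]}^T\boldsymbol{\rho}_{[t]}+\boldsymbol{\eta}_{[t+1]}^T\boldsymbol{\epsilon}_{[t+1]}$ and, for $j=1,\dots,|J|$, $\nu_{j,t+1}=\boldsymbol{\psi}_{j[t]}^T\boldsymbol{\nu}_{j[t]}+\boldsymbol{\phi}_{j[t+1]}^T\boldsymbol{\xi}_{j[t+1]}$,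 where $\boldsymbol{\theta}_{[t]}=(\theta_1,\dots,\theta_t)^T$, $\boldsymbol{\eta}_{[t]}=(\eta_1,\dots,\eta_t)^T$, $\boldsymbol{\psi}_{j[t]}=(\psi_{j1},\dots,\psi_{jt})^T$, $\boldsymbol{\phi}_{j[t]}=(\phi_{j1},\dots,\phi_{jt})^T$ are deterministic real coefficient vectors, $\boldsymbol{\epsilon}_{[t]}=(\epsilon_1,\dots,\epsilon_t)^T$ with $\epsilon_t$ i.i.d. real random variables, and $\boldsymbol{\xi}_{j[t]}=(\xi_{j1},\dots,\xi_{jt})^T$ with $\xi_{jt}$ i.i.d. real random variables. With these dynamics substituted for $\rho_{t+1}$ and $\boldsymbol{\nu}_{t+1}$, the conditional expectation defining $\bar V_t$ is the expectation with respect to $\epsilon_{t+1}$ and $\boldsymbol{\xi}_{t+1}=(\xi_{1,t+1},\dots,\xi_{|J|,t+1})$. A supergradient of a concave function $f$ at $x_0$ is a vector $v$ with $f(x)\le f(x_0)+v^T(x-x_0)$ for all $x$. The superscript $n-1$ merely labels the chosen base point.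
   Formalization: The base point must be one where the value function is finite (a maximum over an empty feasible set counts as −∞, so at other points no hyperplane through the value exists), and the price noises are assumed integrable so that the expectations exist. *)

(* Defs.v *)
From HB Require Import structures.
From mathcomp Require Import all_boot all_order all_algebra.
From mathcomp Require Import all_classical all_reals all_analysis.

Set Implicit Arguments.
Unset Strict Implicit.
Unset Printing Implicit Defensive.

Import Order.TTheory GRing.Theory Num.Theory.
Import numFieldNormedType.Exports.

Local Open Scope classical_set_scope.
Local Open Scope ring_scope.

(* MathComp-Analysis. Periods are numbered from 1, as in the mathematics; the
   history of a quantity up to period t is a matrix with t rows, row s : 'I_t
   (counted from 0) holding period s.+1. Coefficient sequences and noise
   processes are indexed by the period itself; their value at 0 is unused. *)

Section Histories.
Variable R : realType.

(* [snoc H r] adds the row r, for period t.+1, at the bottom of H. *)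
Definition snoc t m (H : 'M[R]_(t, m)) (r : 'rV[R]_m) : 'M[R]_(t.+1, m) :=
  \matrix_(s, j) oapp (fun s' => H s' j) (r 0 j) (unlift ord_max s).

(* The last row, as a column vector; the value for t = 0 is a dummy. *)
Definition current t m : 'M[R]_(t, m) -> 'cV[R]_m :=
  match t with
  | 0 => fun _ => 0
  | t'.+1 => fun H => (row ord_max H)^T
  end.

(* c_[t]^T x_[t] with c_[t] = (c_1, ..., c_t) *)
Definition hist_dot t (c : nat -> R) (x : 'cV[R]_t) : R :=
  \sum_(s < t) c s.+1 * x s 0.

(* c_[t]^T x_[t] + d_[t+1]^T e_[t+1] *)
Definition arma_step t (c d : nat -> R) (x : 'cV[R]_t) (e : 'cV[R]_t.+1) : R :=
  hist_dot c x + hist_dot d e.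

Definition vec_le n (u v : 'cV[R]_n) : Prop := forall j, u j 0 <= v j 0.

End Histories.

Section IID.
Context d (Omega : measurableType d) (R : realType) (P : probability Omega R).

(* X_1, ..., X_m are mutually independent and identically distributed. *)
Definition iid_upto (m : nat) (X : nat -> {RV P >-> R}) : Prop :=
  (forall (s : seq nat) (A : nat -> set R), uniq s ->
     all (fun i => (0 < i <= m)%N) s -> (forall i, measurable (A i)) ->
     P (\bigcap_(i in [set` s]) (X i @^-1` A i)) =
     (\prod_(i <- s) P (X i @^-1` A i))%E) /\
  (forall i k, (0 < i <= m)%N -> (0 < k <= m)%N ->
     forall A : set R, measurable A ->
     distribution P (X i) A = distribution P (X k) A).

End IID.

Record hydro_system (R : realType) (n : nat) := HydroSystem {
  lvl_min : 'cV[R]_n;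
  lvl_max : 'cV[R]_n;
  dis_min : 'cV[R]_n;
  dis_max : 'cV[R]_n;
  rate : 'cV[R]_n;                      (* g *)
  upstream : 'I_n -> {set 'I_n};        (* J^-(j) *)
  theta : nat -> R;
  eta : nat -> R;
  psi : 'I_n -> nat -> R;
  phi : 'I_n -> nat -> R
}.

(* Water never returns to a reservoir it has left. *)
Definition cascade R n (M : @hydro_system R n) : Prop :=
  forall j k : 'I_n, k \in upstream M j ->
    ~~ connect (fun a b : 'I_n => b \in upstream M a) k j.

Section Value.
Context d (Omega : measurableType d) (R : realType) (P : probability Omega R).
Context (n : nat) (M : hydro_system R n) (T : nat).
Context (eps : nat -> {RV P >-> R}) (xi : 'I_n -> nat -> {RV P >-> R}).

Definition G (x : 'cV[R]_n) : R := ((rate M)^T *m x) 0 0.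

Definition routing : 'M[R]_n :=
  \matrix_(j, k) if k == j then -1 else if k \in upstream M j then 1 else 0.

Definition feasible (l v : 'cV[R]_n) : set 'cV[R]_n :=
  [set pi | let lbar := l + routing *m pi in
     [/\ vec_le (lvl_min M) (lbar + v), vec_le (lbar + v) (lvl_max M),
         vec_le (dis_min M) pi & vec_le pi (dis_max M)]].

(* E[rho_{t+1} | history]: the price dynamics averaged over eps_{t+1}, the
   realized prices and noises up to period t being given. *)
Definition expected_price t (rho eh : 'cV[R]_t) : R :=
  fine 'E_P[fun w =>
    arma_step (theta M) (eta M) rho (snoc eh (eps t.+1 w)%:M)].

(* C_t; eh is the realized price noise eps_[t], on which the conditional
   expectation in C_T depends. *)
Definition profit t (pi l : 'cV[R]_n) (nu : 'M[R]_(t, n))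
    (rho eh : 'cV[R]_t) : R :=
  current rho 0 0 * G pi +
  (if t == T then
     expected_price rho eh * G (l + routing *m pi + current nu) else 0).

(* The recursion for the post-decision value function of period t when k
   periods remain. The realized noises eh = eps_[t] and xh = xi_[t] enter the
   moving average terms of period t.+1 and are fixed parameters; only
   eps_{t+1} and xi_{t+1} are integrated. The maximum over an empty feasible
   set is -oo, hence the values in \bar R. *)
Fixpoint value_rec (k t : nat) (lbar : 'cV[R]_n) (nu : 'M[R]_(t, n))
    (rho : 'cV[R]_t) (xh : 'M[R]_(t, n)) (eh : 'cV[R]_t) : \bar R :=
  if k is k'.+1 then
    \int[P]_w (
      let eh' := snoc eh (eps t.+1 w)%:M in
      let xh' := snoc xh (\row_j xi j t.+1 w) in
      let rho' := snoc rho (arma_step (theta M) (eta M) rho eh')%:M in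
      let nu' := snoc nu
        (\row_j arma_step (psi M j) (phi M j) (col j nu) (col j xh')) in
      let l := (lbar + current nu)%R in
      ereal_sup [set ((profit pi l nu' rho' eh')%:E +
                     value_rec k' (l + routing *m pi)%R nu' rho' xh' eh')%E
                | pi in feasible l (current nu')])
  else 0%E.

Definition post_value t := @value_rec (T - t) t.

(* The affine function with slopes a and b through the value at (l0, nu0). *)
Definition hyperplane t (xh : 'M[R]_(t, n)) (eh : 'cV[R]_t)
    (l0 : 'cV[R]_n) (nu0 : 'M[R]_(t, n)) (a : 'cV[R]_n) (b : 'M[R]_(t, n))
    (l : 'cV[R]_n) (nu : 'M[R]_(t, n)) (rho : 'cV[R]_t) : \bar R :=
  (post_value l0 nu0 rho xh eh +
   ((a^T *m (l - l0)) 0 0 + \tr (b^T *m (nu - nu0)))%:E)%E.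

End Value.

(* (a, b) are the components of a supergradient at (l0, nu0) of a function of
   the n + t * n variables l_j and nu_js. *)
Definition is_supergradient (R : realType) n t
    (f : 'cV[R]_n -> 'M[R]_(t, n) -> \bar R)
    (l0 : 'cV[R]_n) (nu0 : 'M[R]_(t, n))
    (a : 'cV[R]_n) (b : 'M[R]_(t, n)) : Prop :=
  forall l nu,
    (f l nu <= f l0 nu0 +
      (\sum_j a j 0 * (l j 0 - l0 j 0) +
       \sum_s \sum_j b s j * (nu s j - nu0 s j))%:E)%E.

(* Main.v *)
(* Given the past, each stage maximizes a concave function over a polyhedron
   whose normals are deterministic: the histories and the inflow noise enter
   only the right-hand sides. By induction on the number of remaining periods,
   the value function is [-oo] outside a polyhedron of states z = (lbar, nu, xi)
   and, inside it, is concave in z, at most K(1 + |p|) in absolute value,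
   K(1 + |p|)-Lipschitz in z and K-Lipschitz in the price data p = (rho, eps).
   The maximum over the discharges preserves this because the feasible set is a
   Lipschitz function of z (Hoffman's bound, from Fourier-Motzkin elimination).
   The expectation preserves it because eps is integrable, and because almost
   sure feasibility only replaces the right-hand sides by essential bounds, so
   that the domain remains polyhedral. A Lipschitz concave function on a
   polyhedron has a finite concave extension to the whole space, hence a
   supergradient at every point of the domain, including its boundary; without
   the Lipschitz bound this fails, as for sqrt at 0. *)

Require Import Defs.
From HB Require Import structures.
From mathcomp Require Import all_boot all_order all_algebra.
From mathcomp Require Import all_classical all_reals all_analysis.
From mathcomp Require Import measurable_realfun.
From mathcomp Require Import ring lra.

Set Implicit Arguments.
Unset Strict Implicit.
Unset Printing Implicit Defensive.

Import Order.TTheory GRing.Theory Num.Theory.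
Import numFieldNormedType.Exports.

Local Open Scope classical_set_scope.
Local Open Scope ring_scope.

(** * Bounded linear maps and Lipschitz maps *)

Section BoundedLinear.
Variable R : realType.
Implicit Types X Y Z : normedModType R.

(** The bound is carried along with linearity because the Lipschitz constants of the value functions
    are built from it. *)
Definition blin X Y (A : X -> Y) : Prop :=
  (forall s x y, A (s *: x + y) = s *: A x + A y) /\
  exists2 K : R, 0 <= K & forall x, `|A x| <= K * `|x|.

Lemma blinP X Y (A : X -> Y) : blin A ->
  forall s x y, A (s *: x + y) = s *: A x + A y.
Proof. by case. Qed.

Lemma blin0 X Y (A : X -> Y) : blin A -> A 0 = 0.
Proof.
move=> hA; have := blinP hA 1 0 0.
by rewrite !scale1r addr0 => /eqP; rewrite -subr_eq0 opprD addNKr oppr_eq0 => /eqP.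
Qed.

Lemma blinD X Y (A : X -> Y) : blin A -> forall x y, A (x + y) = A x + A y.
Proof. by move=> hA x y; rewrite -[x]scale1r (blinP hA) !scale1r. Qed.

Lemma blinZ X Y (A : X -> Y) : blin A -> forall s x, A (s *: x) = s *: A x.
Proof. by move=> hA s x; rewrite -[s *: x]addr0 (blinP hA) (blin0 hA) addr0. Qed.

Lemma blinB X Y (A : X -> Y) : blin A -> forall x y, A (x - y) = A x - A y.
Proof. by move=> hA x y; rewrite blinD// -scaleN1r blinZ// scaleN1r. Qed.

Definition lipschitz_map X Y (f : X -> Y) : Prop :=
  exists2 L : R, 0 <= L & forall x y, `|f x - f y| <= L * `|x - y|.

Lemma blin_lip X Y (A : X -> Y) : blin A -> lipschitz_map A.
Proof.
by move=> hA; case: (hA) => _ [K K0 AK]; exists K => // x y; rewrite -(blinB hA).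
Qed.

Lemma blin_sumE X Y (A : X -> Y) (I : Type) (r : seq I) (f : I -> X) :
  blin A -> A (\sum_(i <- r) f i) = \sum_(i <- r) A (f i).
Proof. by move=> hA; exact: (big_morph A (blinD hA) (blin0 hA)). Qed.

Lemma blin_cst0 X Y : blin (fun _ : X => 0 : Y).
Proof.
split=> [s x y|]; first by rewrite scaler0 addr0.
by exists 0 => // x; rewrite normr0 mul0r.
Qed.

Lemma blin_id X : blin (@id X).
Proof. by split=> //; exists 1 => // x; rewrite mul1r. Qed.

Lemma blin_comp X Y Z (A : X -> Y) (B : Y -> Z) :
  blin A -> blin B -> blin (fun x => B (A x)).
Proof.
move=> hA hB; split=> [s x y|]; first by rewrite (blinP hA) (blinP hB).
case: hA hB => _ [K K0 AK] [_ [L L0 BL]].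
exists (L * K) => [|x]; first exact: mulr_ge0.
by rewrite (le_trans (BL _))// -mulrA ler_wpM2l.
Qed.

Lemma blin_add X Y (A B : X -> Y) :
  blin A -> blin B -> blin (fun x => A x + B x).
Proof.
move=> hA hB; split=> [s x y|].
  by rewrite (blinP hA) (blinP hB) scalerDr addrACA.
case: hA hB => _ [K K0 AK] [_ [L L0 BL]].
exists (K + L) => [|x]; first exact: addr_ge0.
by rewrite (le_trans (ler_normD _ _))// mulrDl lerD.
Qed.

Lemma blin_scale X Y (A : X -> Y) (r : R) : blin A -> blin (fun x => r *: A x).
Proof.
move=> hA; split=> [s x y|].
  by rewrite (blinP hA) scalerDr !scalerA mulrC.
case: hA => _ [K K0 AK].
exists (`|r| * K) => [|x]; first exact: mulr_ge0.
by rewrite normrZ -mulrA ler_wpM2l.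
Qed.

Lemma blin_mull X (A : X -> R) (r : R) : blin A -> blin (fun x => r * A x).
Proof. exact: blin_scale. Qed.

Lemma blin_opp X Y (A : X -> Y) : blin A -> blin (fun x => - A x).
Proof.
move=> /(blin_scale (-1)); congr blin; apply/funext => x.
by rewrite scaleN1r.
Qed.

Lemma blin_sum X Y (I : Type) (r : seq I) (A : I -> X -> Y) :
  (forall i, blin (A i)) -> blin (fun x => \sum_(i <- r) A i x).
Proof.
move=> hA; elim: r => [|i r IH].
  rewrite (_ : (fun _ => _) = fun=> 0); first exact: blin_cst0.
  by apply/funext => x; rewrite big_nil.
rewrite (_ : (fun _ => _) = fun x => A i x + \sum_(j <- r) A j x).
  exact: blin_add.
by apply/funext => x; rewrite big_cons.
Qed.

Lemma blin_fst X Y : blin (fun x : X * Y => x.1).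
Proof.
split=> //; exists 1 => // x.
by rewrite mul1r prod_normE le_max lexx.
Qed.

Lemma blin_snd X Y : blin (fun x : X * Y => x.2).
Proof.
split=> //; exists 1 => // x.
by rewrite mul1r prod_normE le_max lexx orbT.
Qed.

Lemma blin_pair X Y Z (A : X -> Y) (B : X -> Z) :
  blin A -> blin B -> blin (fun x => (A x, B x)).
Proof.
move=> hA hB; split=> [s x y|]; first by rewrite (blinP hA) (blinP hB).
case: hA hB => _ [K K0 AK] [_ [L L0 BL]].
exists (K + L) => [|x]; first exact: addr_ge0.
rewrite prod_normE ge_max/= mulrDl (le_trans (AK x)) ?lerDl ?mulr_ge0//=.
by rewrite (le_trans (BL x)) ?lerDr ?mulr_ge0.
Qed.

Lemma mx_norm_entry m n (A : 'M[R]_(m, n)) i j : `|A i j| <= `|A|.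
Proof.
rewrite [`|A|]/Num.norm/= mx_normrE.
exact: (le_bigmax_cond (0 : R) (fun ij : 'I_m * 'I_n => `|A ij.1 ij.2|) (j:=(i, j))).
Qed.

Lemma mx_norm_le m n (A : 'M[R]_(m, n)) (K : R) : 0 <= K ->
  (forall i j, `|A i j| <= K) -> `|A| <= K.
Proof.
move=> K0 AK; rewrite [`|A|]/Num.norm/= mx_normrE.
by apply/bigmax_leP; split.
Qed.

Lemma blin_entry m n i j : blin (fun A : 'M[R]_(m, n) => A i j).
Proof.
split=> [s x y|]; first by rewrite !mxE.
by exists 1 => // x; rewrite mul1r mx_norm_entry.
Qed.

Lemma blin_mx X m n (A : X -> 'M[R]_(m, n)) :
  (forall i j, blin (fun x => A x i j)) -> blin A.
Proof.
move=> hA; split=> [s x y|].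
  by apply/matrixP => i j; rewrite (blinP (hA i j)) !mxE.
have /choice [K KP] : forall ij : 'I_m * 'I_n, exists K : R,
    0 <= K /\ forall x, `|A x ij.1 ij.2| <= K * `|x|.
  by move=> [i j]; case: (hA i j) => _ [K K0 AK]; exists K.
have K0 : 0 <= \sum_ij K ij by apply: sumr_ge0 => ij _; case: (KP ij).
exists (\sum_ij K ij) => // x.
apply: mx_norm_le => [|i j]; first exact: mulr_ge0.
case: (KP (i, j)) => _ /(_ x) /= /le_trans; apply.
rewrite ler_wpM2r// (bigD1 (i, j))//= lerDl.
by apply: sumr_ge0 => ij _; case: (KP ij).
Qed.

End BoundedLinear.

Arguments blin_entry {R m n} i j.

(** * Polyhedra: stability, Fourier-Motzkin elimination and Hoffman's bound *)

Section Polyhedra.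
Variable R : realType.
Implicit Types X Y : normedModType R.

Definition polyhedral X (D : set X) : Prop :=
  exists (I : finType) (a : I -> X -> R) (c : I -> R),
    (forall i, blin (a i)) /\ D = [set x | forall i, a i x <= c i].

Lemma polyhedral_le X (I : finType) (a : I -> X -> R) (c : I -> R) :
  (forall i, blin (a i)) -> polyhedral [set x | forall i, a i x <= c i].
Proof. by exists I, a, c. Qed.

Lemma polyhedral_ge X (I : finType) (a : I -> X -> R) (c : I -> R) :
  (forall i, blin (a i)) -> polyhedral [set x | forall i, c i <= a i x].
Proof.
move=> ha; exists I, (fun i x => - a i x), (fun i => - c i); split.
  by move=> i; exact: blin_opp.
by apply/seteqP; split => x /= h i; [rewrite lerN2|rewrite -lerN2].
Qed.

Lemma polyhedralT X : polyhedral [set: X].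
Proof.
exists void, (fun _ _ => 0), (fun=> 0); split; first by case.
by apply/seteqP; split => // x _ [].
Qed.

Lemma polyhedralI X (D E : set X) :
  polyhedral D -> polyhedral E -> polyhedral (D `&` E).
Proof.
move=> [I [a [c [ha ->]]]] [J [b [e [hb ->]]]].
exists (I + J)%type, (fun k => match k with inl i => a i | inr j => b j end),
  (fun k => match k with inl i => c i | inr j => e j end); split.
  by case.
apply/seteqP; split => x /=; first by move=> [h1 h2] [].
by move=> h; split=> i; [exact: (h (inl i))|exact: (h (inr i))].
Qed.

Lemma polyhedral_preimage X Y (A : X -> Y) (D : set Y) :
  blin A -> polyhedral D -> polyhedral (A @^-1` D).
Proof.
move=> hA [I [a [c [ha ->]]]]; exists I, (fun i x => a i (A x)), c; split=> //.
by move=> i; exact: blin_comp.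
Qed.

Lemma polyhedral_convex X (D : set X) : polyhedral D ->
  forall x y (s : R), D x -> D y -> 0 <= s <= 1 -> D (s *: x + (1 - s) *: y).
Proof.
move=> [I [a [c [ha ->]]]] x y s /= Dx Dy s01 i.
rewrite (blinP (ha i)) (blinZ (ha i)) /GRing.scale/=.
have := Dx i; have := Dy i; nra.
Qed.

(** Including 0 in the maximum lets the elimination below pick the admissible scalar nearest to 0,
    and covers an empty family of bounds. *)
Let max0P (I : finType) (P : pred I) (f : I -> R) : exists A : R,
  [/\ 0 <= A, forall j, P j -> f j <= A & A = 0 \/ exists2 j, P j & A = f j].
Proof.
exists (\big[Num.max/0]_(j | P j) f j); split.
- exact: bigmax_ge_id.
- by move=> j Pj; exact: le_bigmax_cond.
- elim/big_ind: _ => [|x y hx hy|j Pj]; first by left.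
    by rewrite maxEle; case: ifP.
  by right; exists j.
Qed.

(* Fourier-Motzkin elimination along the direction [e], together with the
   Lipschitz dependence of a solution on the right-hand side. *)
Lemma polyhedral_sat1 X (D : set X) (e : X) : polyhedral D ->
  polyhedral [set x | exists s : R, D (x + s *: e)] /\
  exists2 K : R, 0 <= K & forall x x', D x ->
    (exists s : R, D (x' + s *: e)) ->
    exists2 s : R, D (x' + s *: e) & `|s| <= K * `|x - x'|.
Proof.
move=> [I [a [c [ha DE]]]]; pose b i := a i e.
have aE i x s : a i (x + s *: e) = a i x + s * b i.
  by rewrite (blinD (ha i)) (blinZ (ha i)).
(* The eliminated system: rows in which [e] has coefficient 0 are kept, and rows with coefficients
   of opposite signs are combined in pairs so that the [e]-terms cancel. *)
pose sys x := forall ij : I * I,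
  (b ij.1 = 0 -> a ij.1 x <= c ij.1) /\
  (0 < b ij.1 -> b ij.2 < 0 ->
   - b ij.2 * (a ij.1 x - c ij.1) + b ij.1 * (a ij.2 x - c ij.2) <= 0).
have nec x : (exists s : R, D (x + s *: e)) -> sys x.
  move=> [s]; rewrite DE/= => h [i j] /=; have := h i; have := h j.
  rewrite !aE => hj hi; split=> [b0|bi bj].
    by move: hi; rewrite b0 mulr0 addr0.
  nra.
(* [L j x] is the scalar at which row [j] becomes an equality along [e]: a lower bound for [s] if
   [b j < 0], an upper bound if [b j > 0]. *)
pose L j x := (a j x - c j) / - b j.
(* The solution is 0, the largest lower bound or the smallest upper bound. For a nonzero choice,
   [L j x * - b j] equals [a j x - c j], and its positivity says that row [j] is violated at
   [s = 0]. *)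
have sol x : sys x -> exists2 s, D (x + s *: e) &
    s = 0 \/ exists2 j, b j != 0 & (0 < L j x * - b j) /\ s = L j x.
  move=> hx.
  have [A [A0 AL hA]] := max0P (fun j => b j < 0) (fun j => L j x).
  have [B [B0 BL hB]] := max0P (fun j => b j > 0) (fun j => - L j x).
  have LE j : b j != 0 -> L j x * - b j = a j x - c j.
    by move=> bj; rewrite /L divfK// oppr_eq0.
  have LU i j : 0 < b i -> b j < 0 -> L j x <= L i x.
    move=> bi bj; have [_ /(_ bi bj)/=] := hx (i, j).
    rewrite -(LE i (lt0r_neq0 bi)) -(LE j (ltr0_neq0 bj)) => h.
    have p : 0 < b i * - b j by rewrite mulr_gt0 ?oppr_gt0.
    by rewrite -(ler_pM2l p); lra.
  have hD s : (forall j, b j < 0 -> L j x <= s) ->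
      (forall j, 0 < b j -> s <= L j x) -> D (x + s *: e).
    move=> h1 h2; rewrite DE/= => i; rewrite aE.
    have [bi|bi|b0] := ltgtP (b i) 0.
    - have := h1 i bi; have := LE i (negbT (lt_eqF bi)); nra.
    - have := h2 i bi; have := LE i (negbT (gt_eqF bi)); nra.
    - by have [/(_ b0)/= + _] := hx (i, i); rewrite b0 mulr0 addr0.
  have [A0'|[j bj Aj]] := hA.
    have [B0'|[i bi Bi]] := hB.
      exists 0; last by left.
      apply: hD => j bj; first by rewrite -A0' AL.
      by have := BL j bj; rewrite B0' oppr_le0.
    exists (L i x).
      apply: hD => j bj; first exact: LU.
      by have := BL j bj; rewrite Bi lerN2.
    have [L0|L0] := eqVneq (L i x) 0; first by left.
    right; exists i; first by rewrite gt_eqF.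
    split=> //; move: B0; rewrite Bi; move: L0 => /eqP; nra.
  exists (L j x).
    apply: hD => i bi; first by rewrite -Aj AL.
    exact: LU.
  have [L0|L0] := eqVneq (L j x) 0; first by left.
  right; exists j; first by rewrite lt_eqF.
  split=> //; move: A0; rewrite Aj; move: L0 => /eqP; nra.
split.
  rewrite (_ : mkset _ = [set x | forall ij : I * I,
      (if b ij.1 == 0 then a ij.1 x else 0) <= (if b ij.1 == 0 then c ij.1 else 0)]
      `&` [set x | forall ij : I * I,
      (if (0 < b ij.1) && (b ij.2 < 0) then
         - b ij.2 * a ij.1 x + b ij.1 * a ij.2 x else 0) <=
      (if (0 < b ij.1) && (b ij.2 < 0) then
         - b ij.2 * c ij.1 + b ij.1 * c ij.2 else 0)]).
    apply: polyhedralI; apply: polyhedral_le => -[i j] /=.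
      by case: (b i == 0); [exact: ha|exact: blin_cst0].
    case: (_ && _); last exact: blin_cst0.
    by apply: blin_add; exact: blin_mull.
  apply/seteqP; split => x /=.
    move=> /nec hx; split=> -[i j] /=; have [/= h1 h2] := hx (i, j).
      by case: eqP.
    case: ifPn => // /andP[bi bj]; have := h2 bi bj; nra.
  move=> [h1 h2].
  have /sol[s Ds _] : sys x; last by exists s.
  move=> [i j]; split=> /=; first by move=> b0; have := h1 (i, j); rewrite /= b0 eqxx.
  by move=> bi bj; have := h2 (i, j); rewrite /= bi bj/=; nra.
have /choice [k kP] : forall i, exists k : R, 0 <= k /\ forall x, `|a i x| <= k * `|x|.
  by move=> i; case: (ha i) => _ [k k0 hk]; exists k.
have t0 i : 0 <= k i / `|b i| by apply: divr_ge0 => //; case: (kP i).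
have K0 : 0 <= \sum_i (k i / `|b i|) by apply: sumr_ge0.
exists (\sum_i (k i / `|b i|)) => // x x' Dx /nec/sol [s Ds hs]; exists s => //.
case: hs => [->|[j bj [L0 ->]]]; first by rewrite normr0 mulr_ge0.
apply: (@le_trans _ _ (k j / `|b j| * `|x - x'|)); last first.
  rewrite ler_wpM2r// (bigD1 j)//= lerDl; exact: sumr_ge0.
rewrite /L normrM normfV normrN mulrAC ler_wpM2r ?invr_ge0//.
(* Row [j] is violated at [x'] but satisfied at [x], so its excess at [x'] is at most
   [a j x' - a j x], hence at most [k j] times the distance between the points. *)
move: L0; rewrite /L divfK ?oppr_eq0// => L0.
rewrite gtr0_norm//; apply: (@le_trans _ _ (a j x' - a j x)).
  by rewrite lerD2l lerN2; move: Dx; rewrite DE.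
rewrite -(blinB (ha j)) distrC (le_trans (ler_norm _))//.
by case: (kP j).
Qed.

(** Hoffman's bound: the coordinates of [u] are eliminated one at a time with [polyhedral_sat1], and
    the moves in the successive coordinates add up to a correction of controlled size. *)
Lemma polyhedral_sat X n (D : set X) (iota : 'cV[R]_n -> X) :
  blin iota -> polyhedral D ->
  polyhedral [set x | exists u, D (x + iota u)] /\
  exists2 K : R, 0 <= K & forall x x', D x -> (exists u, D (x' + iota u)) ->
    exists2 u, D (x' + iota u) & `|u| <= K * `|x - x'|.
Proof.
move=> hi hD.
(* Only the first [k] coordinates of [u] may be nonzero, so [sat] grows from [D] at [k = 0] to the
   full set of solvable points at [k = n]. *)
pose sat k : set X := [set x | exists2 u : 'cV_n,
  (forall j : 'I_n, (k <= j)%N -> u j 0 = 0) & D (x + iota u)].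
have main k : (k <= n)%N -> polyhedral (sat k) /\
    exists2 K : R, 0 <= K & forall x x', D x -> sat k x' ->
    exists2 u : 'cV_n, (forall j : 'I_n, (k <= j)%N -> u j 0 = 0) /\ D (x' + iota u)
      & `|u| <= K * `|x - x'|.
  elim: k => [_|k IH kn].
    have s0 : sat 0%N = D.
      apply/seteqP; split => x /=; last first.
        by move=> Dx; exists 0; rewrite ?(blin0 hi) ?addr0// => j _; rewrite mxE.
      move=> [u u0]; rewrite (_ : u = 0) ?(blin0 hi) ?addr0//.
      by apply/matrixP => i j; rewrite ord1 u0// mxE.
    split; first by rewrite s0.
    exists 0 => // x x' Dx; rewrite s0 => Dx'; exists 0; last by rewrite normr0 mul0r.
    by rewrite (blin0 hi) addr0; split=> // j _; rewrite mxE.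
  have [pk [K K0 hK]] := IH (ltnW kn).
  pose ek : 'cV[R]_n := delta_mx (Ordinal kn) 0.
  have [pS [L L0 hL]] := polyhedral_sat1 (iota ek) pk.
  have satS x : sat k.+1 x <-> exists s : R, sat k (x + s *: iota ek).
    split=> [[u u0 Du]|[s [u u0 Du]]].
      exists (u (Ordinal kn) 0), (u - u (Ordinal kn) 0 *: ek).
        move=> j; rewrite leq_eqVlt => /predU1P[kj|kj].
          rewrite (_ : j = Ordinal kn); last exact/val_inj.
          by rewrite !mxE !eqxx mulr1 subrr.
        rewrite !mxE eqxx andbT (u0 j)// (_ : (j == _) = false) ?mulr0 ?subr0//.
        by apply/eqP => jk; move: kj; rewrite jk/= ltnn.
      by rewrite -addrA -(blinZ hi) -(blinD hi) addrC addrC subrKC.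
    exists (s *: ek + u); last by rewrite (blinP hi) addrA.
    move=> j kj; rewrite !mxE eqxx andbT (u0 j) 1?ltnW// addr0.
    rewrite (_ : (j == _) = false) ?mulr0//.
    by apply/eqP => jk; move: kj; rewrite jk/= ltnn.
  split.
    rewrite (_ : sat k.+1 = [set x | exists s : R, sat k (x + s *: iota ek)])//.
    by apply/seteqP; split => x /satS.
  (* A move along [ek] of size at most [L] times the distance brings [x'] into [sat k]. The distance
     to [x] grows by a factor of at most [1 + L * |iota ek|] before the induction hypothesis is
     applied. *)
  exists (L + K * (1 + L * `|iota ek|)) => [|x x' Dx].
    by rewrite addr_ge0// mulr_ge0// addr_ge0// mulr_ge0.
  move=> /satS hx'.
  have Sx : sat k x.
    by exists 0; rewrite ?(blin0 hi) ?addr0// => j _; rewrite mxE.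
  have [s Ss sL] := hL x x' Sx hx'.
  have [u [u0 Du] uK] := hK x _ Dx Ss.
  exists (s *: ek + u).
    split; last by rewrite (blinP hi) addrA.
    move=> j kj; rewrite !mxE eqxx andbT (u0 j) 1?ltnW// addr0.
    rewrite (_ : (j == _) = false) ?mulr0//.
    by apply/eqP => jk; move: kj; rewrite jk/= ltnn.
  rewrite (le_trans (ler_normD _ _))// mulrDl lerD//.
    rewrite normrZ (le_trans _ sL)// ler_piMr//.
    apply: mx_norm_le => // i j; rewrite !mxE.
    by case: (_ && _); rewrite ?normr1 ?normr0.
  rewrite (le_trans uK)// -mulrA ler_wpM2l// opprD addrA.
  rewrite (le_trans (ler_normB _ _))// mulrDl mul1r lerD2l normrZ.
  by rewrite mulrAC ler_wpM2r.
have [pn [K K0 hK]] := main n (leqnn n).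
have sE : [set x | exists u, D (x + iota u)] = sat n.
  apply/seteqP; split => x [u]; last by exists u.
  by exists u => // j; rewrite leqNgt ltn_ord.
split; first by rewrite sE.
exists K => // x x' Dx hx'.
have : sat n x' by rewrite -sE.
by move=> /(hK _ _ Dx)[u [_ Du] uK]; exists u.
Qed.

End Polyhedra.

(** * Lipschitz concave functions: sums, substitutions and maxima *)

Section LipschitzConcave.
Variable R : realType.
Implicit Types X Y P Q : normedModType R.

(* [x] is a state and [p] a parameter in which [v] need not be concave (the
   prices multiply the discharges). *)
Definition lipconc X P (D : set X) (v : X -> P -> R) : Prop :=
  exists2 K : R, 0 <= K &
  [/\ forall x p, D x -> `|v x p| <= K * (1 + `|p|),
      forall x y p, D x -> D y -> v x p <= v y p + K * (1 + `|p|) * `|x - y|,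
      forall x p q, D x -> v x p <= v x q + K * `|p - q| &
      forall x y p s, D x -> D y -> 0 <= s <= 1 ->
        s * v x p + (1 - s) * v y p <= v (s *: x + (1 - s) *: y) p].

(** Linear growth, in the form that turns bounds in the norm of [f x] into the bounds required by
    [lipconc]. *)
Lemma lipschitz_map_bound X Y (f : X -> Y) : lipschitz_map f ->
  exists2 L : R, 0 <= L & forall x, 1 + `|f x| <= L * (1 + `|x|).
Proof.
move=> [L L0 fL]; exists (1 + `|f 0| + L) => [|x]; first by rewrite !addr_ge0.
have := fL x 0; rewrite subr0.
have := ler_normD (f x - f 0) (f 0); rewrite subrK.
have := normr_ge0 (f 0); have := normr_ge0 x; nra.
Qed.

Lemma lipconc0 X P (D : set X) : lipconc D (fun (_ : X) (_ : P) => 0).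
Proof.
exists 0 => //; split=> *; rewrite ?normr0 ?mul0r ?addr0 ?mulr0//.
Qed.

Lemma lipconc_add X P (D E : set X) (v w : X -> P -> R) :
  lipconc D v -> lipconc E w -> lipconc (D `&` E) (fun x p => v x p + w x p).
Proof.
move=> [K K0 [v1 v2 v3 v4]] [L L0 [w1 w2 w3 w4]].
exists (K + L); first exact: addr_ge0.
split=> [x p [Dx Ex]|x y p [Dx Ex] [Dy Ey]|x p q [Dx Ex]|x y p s [Dx Ex] [Dy Ey] s01].
- by rewrite (le_trans (ler_normD _ _))// mulrDl lerD ?v1 ?w1.
- have := v2 x y p Dx Dy; have := w2 x y p Ex Ey; lra.
- have := v3 x p q Dx; have := w3 x p q Ex; lra.
- have := v4 x y p s Dx Dy s01; have := w4 x y p s Ex Ey s01; lra.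
Qed.

Lemma lipconc_preimage X Y P (A : X -> Y) (D : set Y) (v : Y -> P -> R) :
  blin A -> lipconc D v -> lipconc (A @^-1` D) (fun x p => v (A x) p).
Proof.
move=> hA [K K0 [v1 v2 v3 v4]]; have [L L0 AL] := blin_lip hA.
have KL : 0 <= K * L by exact: mulr_ge0.
exists (K + K * L); first exact: addr_ge0.
split=> [x p Dx|x y p Dx Dy|x p q Dx|x y p s Dx Dy s01].
- rewrite (le_trans (v1 _ p Dx))// ler_wpM2r ?lerDl//.
- rewrite (le_trans (v2 _ _ p Dx Dy))// lerD2l.
  have := ler_wpM2l (mulr_ge0 K0 (addr_ge0 ler01 (normr_ge0 p))) (AL x y).
  move=> /le_trans; apply.
  rewrite (_ : K * (1 + `|p|) * (L * `|x - y|) = K * L * (1 + `|p|) * `|x - y|); last by ring.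
  by rewrite !ler_wpM2r ?lerDr ?addr_ge0.
- rewrite (le_trans (v3 _ p q Dx))// lerD2l ler_wpM2r ?lerDl//.
- by rewrite (blinP hA) (blinZ hA); exact: v4.
Qed.

(** For fixed [p] the product is linear in [x], hence concave whatever the sign of [r p].
    Boundedness of [A] on [D] makes the Lipschitz constant in [p] uniform in the state. *)
Lemma lipconc_bilin X P (D : set X) (r : P -> R) (A : X -> R) (C : R) :
  lipschitz_map r -> blin A -> (forall x, D x -> `|A x| <= C) ->
  lipconc D (fun x p => r p * A x).
Proof.
move=> hr hA AC; have [L L0 rL] := lipschitz_map_bound hr.
have [N N0 AN] := blin_lip hA; case: hr => [M M0 rM].
have rL' p : `|r p| <= L * (1 + `|p|) by rewrite (le_trans _ (rL p))// lerDr.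
have C0 : 0 <= `|C| by [].
have AC' x : D x -> `|A x| <= `|C|.
  by move=> /AC /le_trans; apply; exact: ler_norm.
have LC : 0 <= L * `|C| by exact: mulr_ge0.
have LN : 0 <= L * N by exact: mulr_ge0.
have MC : 0 <= M * `|C| by exact: mulr_ge0.
exists (L * `|C| + L * N + M * `|C|); first by rewrite !addr_ge0.
have p1 p : 0 <= 1 + `|p : P| by exact: addr_ge0.
split=> [x p Dx|x y p Dx Dy|x p q Dx|x y p s Dx Dy s01].
- rewrite normrM (le_trans (ler_pM _ _ (rL' p) (AC' _ Dx)))//.
  by rewrite mulrAC ler_wpM2r// -addrA lerDl addr_ge0.
- rewrite -lerBlDl -mulrBr (le_trans (ler_norm _))// normrM.
  rewrite (le_trans (ler_pM _ _ (rL' p) (AN x y)))//.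
  rewrite (_ : L * (1 + `|p|) * (N * `|x - y|) = L * N * (1 + `|p|) * `|x - y|); last by ring.
  by rewrite !ler_wpM2r// addrAC lerDr addr_ge0.
- rewrite -lerBlDl -mulrBl (le_trans (ler_norm _))// normrM.
  rewrite (le_trans (ler_pM _ _ (rM p q) (AC' _ Dx)))//.
  by rewrite mulrAC ler_wpM2r// lerDr addr_ge0.
- rewrite (blinP hA) (blinZ hA) /GRing.scale/=; lra.
Qed.

(** Applied twice in a row, this carries a concavity inequality through the suprema at both
    endpoints. *)
Lemma mulr_sup_le (S : set R) (s c : R) : 0 <= s -> S !=set0 ->
  (forall a, S a -> s * a <= c) -> s * sup S <= c.
Proof.
rewrite le_eqVlt => /predU1P[<-|s0] S0 h.
  by case: S0 => a /h; rewrite !mul0r.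
rewrite mulrC -ler_pdivlMr//; apply: ge_sup => // a Sa.
by rewrite ler_pdivlMr// mulrC h.
Qed.

(** By Hoffman's bound, a choice [u] feasible at one state can be moved to a feasible choice at
    another state over a distance proportional to that of the states, so the maxima differ by a
    Lipschitz term. Concavity comes from joint convexity of [D] in state and choice. *)
Lemma lipconc_sup X P n (D : set (X * 'cV[R]_n)) (v : X * 'cV[R]_n -> P -> R) :
  polyhedral D -> lipconc D v ->
  polyhedral [set x | exists u, D (x, u)] /\
  lipconc [set x | exists u, D (x, u)]
    (fun x p => sup [set v (x, u) p | u in [set u | D (x, u)]]).
Proof.
move=> pD [K K0 [v1 v2 v3 v4]].
have hi : blin (fun u : 'cV[R]_n => (0 : X, u)).
  by apply: blin_pair; [exact: blin_cst0|exact: blin_id].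
have [pS [H H0 hH]] := polyhedral_sat hi pD.
have addE x (u u' : 'cV[R]_n) : (x, u) + (0 : X, u') = (x, u + u').
  by congr pair; rewrite addr0.
(* The bound is applied to [(x, u)] in [D] and to [(x', u)], which differs from it only in the
   state; the correction acts on the second component alone. *)
have hof x x' u : D (x, u) -> (exists u', D (x', u')) ->
    exists2 u', D (x', u') & `|u - u'| <= H * `|x - x'|.
  move=> Dxu [u1 Du1].
  have [|u2] := hH (x, u) (x', u) Dxu.
    by exists (u1 - u); rewrite addE addrC subrK.
  rewrite addE => Du2 uH; exists (u + u2) => //.
  rewrite opprD addNKr normrN (le_trans uH)//.
  rewrite (_ : (x, u) - (x', u) = (x - x', 0)); last by congr pair; rewrite /= subrr.
  by rewrite prod_normE/= normr0 max_l.
pose S x p := [set v (x, u) p | u in [set u | D (x, u)]].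
have p1 p : 0 <= 1 + `|p : P| by exact: addr_ge0.
have ubS x p : ubound (S x p) (K * (1 + `|p|)).
  by move=> _ [u Du <-]; rewrite (le_trans (ler_norm _))// v1.
have leS x p u : D (x, u) -> v (x, u) p <= sup (S x p).
  by move=> Du; apply: ub_le_sup; [exists (K * (1 + `|p|)); exact: ubS|exists u].
have S0 x p : (exists u, D (x, u)) -> S x p !=set0.
  by move=> [u Du]; exists (v (x, u) p), u.
have KH : 0 <= K * H by exact: mulr_ge0.
split.
  rewrite (_ : mkset _ = (fun x => (x, 0)) @^-1`
      [set x | exists u, D (x + (0 : X, u))]).
    apply: polyhedral_preimage pS.
    by apply: blin_pair; [exact: blin_id|exact: blin_cst0].
  by apply/seteqP; split => x /= [u Du]; exists u; move: Du; rewrite addE add0r.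
exists (K * (1 + H)); first by rewrite mulr_ge0// addr_ge0.
split=> [x p Dx|x y p Dx Dy|x p q Dx|x y p s Dx Dy s01].
- apply: (@le_trans _ _ (K * (1 + `|p|))); last first.
    by rewrite ler_wpM2r// mulrDr mulr1 lerDl.
  rewrite ler_norml; apply/andP; split; last by apply: ge_sup; [exact: S0|exact: ubS].
  case: Dx => u Du; rewrite (le_trans _ (leS x p u Du))//.
  by have := v1 _ p Du; rewrite ler_norml => /andP[].
- apply: ge_sup; first exact: S0.
  move=> _ [u Du <-]; have [u' Du' uH] := hof x y u Du Dy.
  rewrite (le_trans (v2 _ _ p Du Du'))// lerD ?leS//.
  rewrite (_ : K * (1 + H) * (1 + `|p|) * `|x - y| =
    K * (1 + `|p|) * ((1 + H) * `|x - y|)); last by ring.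
  rewrite ler_wpM2l ?mulr_ge0// prod_normE/= ge_max mulrDl mul1r.
  by rewrite lerDl mulr_ge0//= (le_trans uH)// lerDr.
- apply: ge_sup; first exact: S0.
  move=> _ [u Du <-]; rewrite (le_trans (v3 _ p q Du))// lerD ?leS//.
  by rewrite ler_wpM2r// mulrDr mulr1 lerDl.
- have /andP[s0 s1] := s01.
  rewrite -lerBrDr; apply: mulr_sup_le => //; first exact: S0.
  move=> _ [u Du <-]; rewrite lerBrDr addrC -lerBrDr.
  apply: mulr_sup_le; [by rewrite subr_ge0|exact: S0|].
  move=> _ [u' Du' <-]; rewrite lerBrDr addrC.
  rewrite (le_trans (v4 _ _ p s Du Du' s01))//.
  have := polyhedral_convex pD Du Du' s01.
  exact: leS.
Qed.

End LipschitzConcave.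

(** * Expectation over the noise: measurability, essential bounds and stability *)

Section Expectation.
Context d (Omega : measurableType d) (R : realType) (P : probability Omega R).

(** The maximum of [f] and [g] dominates [f] everywhere and equals [g] almost everywhere, which
    reduces the claim to a pointwise comparison. *)
Lemma le_Rintegral_ae (f g : Omega -> R) :
  P.-integrable setT (EFin \o f) -> P.-integrable setT (EFin \o g) ->
  (\forall w \ae P, f w <= g w) ->
  \int[P]_w f w <= \int[P]_w g w.
Proof.
move=> fi gi fg; pose h w := Num.max (f w) (g w).
have mf : measurable_fun setT f by apply/measurable_EFinP; exact: measurable_int fi.
have mg : measurable_fun setT g by apply/measurable_EFinP; exact: measurable_int gi.
have mh : measurable_fun setT h by exact: measurable_maxr.
have hi : P.-integrable setT (EFin \o h).
  apply: (@le_integrable _ _ _ _ _ _ _ (fun w => (`|f w|%:E + `|g w|%:E)%E)) => //.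
  - exact/measurable_EFinP.
  - move=> w _ /=; rewrite lee_fin [leRHS]ger0_norm ?addr_ge0//.
    by rewrite /h maxEle; case: ifP => _; rewrite ?lerDl ?lerDr.
  - by apply: integrableD => //; exact: integrable_norm.
apply: (@le_trans _ _ (\int[P]_w h w)).
  by apply: le_Rintegral => // w _; rewrite /h le_max lexx.
rewrite le_eqVlt; apply/orP; left; apply/eqP; congr fine.
apply: ae_eq_integral => //.
- exact/measurable_EFinP.
- exact/measurable_EFinP.
- apply: filterS fg => w fgw _; rewrite /h; congr EFin.
  by apply/max_idPr.
Qed.

(** The positive part has a finite integral thanks to the integrable bound [h]; the negative part
    has an infinite one because [-oo] is taken on a set of positive measure. *)
Lemma integral_ninfty (f : Omega -> \bar R) (h : Omega -> R) :
  measurable_fun setT f -> P.-integrable setT (EFin \o h) ->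
  (forall w, (f w <= (h w)%:E)%E) ->
  ~ (\forall w \ae P, f w != -oo%E) -> (\int[P]_w f w = -oo)%E.
Proof.
move=> mf hi fh nf; pose N := f @^-1` [set -oo%E].
have mN : measurable N by rewrite -[N]setTI; apply: mf => //; exact: emeasurable_set1.
have PN : (0 < P N)%E.
  rewrite lt0e measure_ge0 andbT; apply/eqP => PN0; apply: nf.
  exists N; split => // w /=.
  by move=> /negP; rewrite negbK => /eqP.
have fp : (\int[P]_w f^\+ w < +oo)%E.
  apply: (@le_lt_trans _ _ (\int[P]_w `|(h w)%:E|)%E).
    apply: ge0_le_integral => //; first exact: measurable_funepos.
      apply: measurableT_comp => //; exact: measurable_int hi.
    move=> w _; rewrite funeposE ge_max; apply/andP; split; last exact: abse_ge0.
    by rewrite (le_trans (fh w))// lee_fin ler_norm.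
  by case/integrableP : hi.
have fn : (\int[P]_w f^\- w = +oo)%E.
  apply/eqP; rewrite -leye_eq.
  apply: (@le_trans _ _ (\int[P]_(w in N) f^\- w)%E); last first.
    by apply: ge0_subset_integral => //; exact: measurable_funeneg.
  rewrite (@eq_integral _ _ _ _ _ (cst +oo%E)).
    by rewrite integral_cst// gt0_mulye.
  by move=> w; by rewrite inE/N/= funenegE => ->.
rewrite integralE fn; move: fp.
by case: (\int[P]_w f^\+ w)%E => // r _.
Qed.

Context n (xi : 'I_n -> Omega -> R) (eps : Omega -> R).
Hypothesis mxi : forall j, measurable_fun setT (xi j).
Hypothesis ieps : P.-integrable setT (EFin \o eps).

Definition noise w : 'rV[R]_n := \row_j xi j w.

(* Every open set of noises is a countable union of rational boxes. *)
Lemma measurable_noise_fun (S : set 'rV[R]_n) (F : 'rV[R]_n -> R -> R) :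
  measurable [set w | S (noise w)] ->
  (forall y e c, S y -> c < F y e -> exists2 r : R, 0 < r &
     forall y' e', S y' -> `|y - y'| < r -> `|e - e'| < r -> c < F y' e') ->
  measurable_fun setT (fun w => if `[< S (noise w) >] then F (noise w) (eps w) else 0).
Proof.
move=> mS hF.
have meps : measurable_fun setT eps.
  by apply/measurable_EFinP; exact: measurable_int ieps.
apply: measurable_fun_if => //.
- apply: (measurable_fun_bool true); rewrite setTI.
  by rewrite (_ : _ @^-1` _ = [set w | S (noise w)])//; apply/seteqP; split => w /asboolP.
- rewrite setTI (_ : _ @^-1` _ = [set w | S (noise w)]); last first.
    by apply/seteqP; split => w /asboolP.
  move=> _; apply: (measurability _ (RGenOInfty.measurableE R)).
  move=> /= _ [_ [c ->] <-].
  pose box (q : 'rV[rat]_n) (r : rat) (k : nat) : set Omega :=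
    (\bigcap_(j in [set: 'I_n])
      (setT `&` xi j @^-1` `](ratr (q 0 j) - k.+1%:R^-1), (ratr (q 0 j) + k.+1%:R^-1)[)) `&`
    (setT `&` eps @^-1` `](ratr r - k.+1%:R^-1), (ratr r + k.+1%:R^-1)[).
  have mbox q r k : measurable (box q r k).
    apply: measurableI.
      by apply: fin_bigcap_measurable => // j _; apply: mxi => //; exact: measurable_itv.
    by apply: meps => //; exact: measurable_itv.
  (* Among the countably many boxes, the good ones are those where the superlevel condition holds at
     every noise in [S]; they cover the superlevel set. *)
  pose good (i : 'rV[rat]_n * rat * nat) :=
    forall w, S (noise w) -> box i.1.1 i.1.2 i.2 w -> c < F (noise w) (eps w).
  rewrite (_ : _ `&` _ = [set w | S (noise w)] `&`
    \bigcup_i (if `[< good i >] then box i.1.1 i.1.2 i.2 else set0)).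
    apply: measurableI => //; apply: countable_bigcupT_measurable => // i.
    by case: ifP.
  apply/seteqP; split => w /=; last first.
    move=> [Sw [i _]]; case: ifPn => // /asboolP gi bw; split=> //.
    by rewrite in_itv/= andbT; exact: gi.
  move=> [Sw]; rewrite in_itv/= andbT => cF; split=> //.
  have [r r0 hr] := hF _ _ _ Sw cF.
  (* Two points of one box of half-width [1/(k+1)] differ by less than [2/(k+1)] in each coordinate,
     which has to stay below [r]. *)
  have [k kr] : exists k : nat, k.+1%:R^-1 < r / 2.
    have r2 : 0 < r / 2 by rewrite divr_gt0.
    have [k] := ltr_add_invr r2; rewrite add0r => hk; by exists k.
  have k0 : (0 : R) < k.+1%:R^-1 by rewrite invr_gt0.
  have apx (x : R) : exists q : rat, x - k.+1%:R^-1 < ratr q < x + k.+1%:R^-1.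
    have /rat_in_itvoo[q] : x - k.+1%:R^-1 < x + k.+1%:R^-1.
      by rewrite ltrBlDr -addrA ltrDl addr_gt0.
    by rewrite in_itv/=; exists q.
  have /choice[q hq] : forall j, exists q : rat,
      xi j w - k.+1%:R^-1 < ratr q < xi j w + k.+1%:R^-1 by move=> j; exact: apx.
  have [p hp] := apx (eps w).
  exists ((\row_j q j, p), k) => //.
  case: ifPn => [_|/asboolP[]].
    split=> /=.
      move=> j _; split=> //=; rewrite !mxE in_itv/=; move: (k.+1%:R^-1) k0 (hq j) => dl; lra.
    by split=> //=; rewrite in_itv/=; move: (k.+1%:R^-1) k0 hp => dl; lra.
  move=> w' Sw' /= [bw1 [_]]; rewrite /= in_itv/= => bw2.
  apply: hr => //; last first.
    by rewrite ltr_norml; move: (k.+1%:R^-1) k0 kr hp bw2 => dl; lra.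
  apply: (@le_lt_trans _ _ (k.+1%:R^-1 *+ 2)); last first.
    by rewrite mulr2n; move: (k.+1%:R^-1) kr => dl; lra.
  apply: mx_norm_le => [|i j]; first by rewrite mulrn_wge0// ltW.
  rewrite !mxE; have := hq j; have [_] := bw1 j I.
  rewrite /= mxE in_itv/= mulr2n ler_norml.
  by move: (k.+1%:R^-1) => dl; lra.
- exact: mS.
Qed.

Context (Z Q Q' : normedModType R).
Implicit Types (D : set (Z * 'rV[R]_n)).

Lemma blin_left (A : Z * 'rV[R]_n -> R) : blin A -> blin (fun z => A (z, 0)).
Proof.
move=> hA; apply: (@blin_comp _ _ _ _ (fun z : Z => (z, 0 : 'rV[R]_n))) => //.
by apply: blin_pair; [exact: blin_id|exact: blin_cst0].
Qed.

Lemma blin_split (A : Z * 'rV[R]_n -> R) z y : blin A ->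
  A (z, y) = A (z, 0) + A (0, y).
Proof.
by move=> hA; rewrite -(blinD hA); congr A; congr pair; rewrite /= ?addr0 ?add0r.
Qed.

Lemma measurable_polyhedral_noise D z : polyhedral D ->
  measurable [set w | D (z, noise w)].
Proof.
move=> [I [a [c [ha ->]]]].
rewrite (_ : mkset _ = \bigcap_(i in [set: I]) [set w | a i (z, noise w) <= c i]);
  last by apply/seteqP; split => w /= h i *; exact: h.
apply: fin_bigcap_measurable => // i _.
have mf : measurable_fun setT (fun w => a i (z, noise w)).
  rewrite (_ : (fun w => _) = fun w => if `[< setT (noise w) >]
      then (fun y (_ : R) => a i (z, y)) (noise w) (eps w) else 0); last first.
    by apply/funext => w; case: asboolP => // -[].
  apply: (@measurable_noise_fun setT (fun y _ => a i (z, y))).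
    exact: measurableT.
  move=> y e b _ hb.
  have [K K0 aK] := blin_lip (ha i).
  have K1 : 0 < K + 1 by rewrite ltr_wpDl.
  exists ((a i (z, y) - b) / (K + 1)); first by rewrite divr_gt0// subr_gt0.
  move=> y' _ _ + _; rewrite ltr_pdivlMr// => h.
  have := aK (z, y) (z, y').
  rewrite (_ : (z, y) - (z, y') = (0, y - y')); last by congr pair; rewrite /= subrr.
  rewrite prod_normE/= normr0 max_r// => h2.
  have := ler_norm (a i (z, y) - a i (z, y')); have := normr_ge0 (y - y'); lra.
rewrite (_ : mkset _ = setT `&` (fun w => a i (z, noise w)) @^-1` `]-oo, c i]); last first.
  by apply/seteqP; split => w /=; rewrite in_itv/= => // -[].
exact: (mf measurableT _ (measurable_itv _)).
Qed.

(** The admissible [r] form a down-closed set: empty, the whole line or a closed half-line. The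
    pairs [(0, -1)], [(0, 0)] and [(1, sup C)] encode the three cases as one linear inequality. *)
Lemma ae_le_halfline (Y : Omega -> R) (c : R) : exists (s m : R),
  forall r, (\forall w \ae P, r + Y w <= c) <-> s * r <= m.
Proof.
pose C := [set r | \forall w \ae P, r + Y w <= c].
have Cd r r' : C r -> r' <= r -> C r'.
  by move=> Cr rr'; apply: filterS Cr => w; apply: le_trans; rewrite lerD2r.
have [[r0 Cr0]|C0] := pselect (exists r, C r); last first.
  by exists 0, (-1) => r; rewrite mul0r; split=> [Cr|]; [case: C0; exists r|lra].
have [ub|nub] := pselect (has_ubound C); last first.
  exists 0, 0 => r; rewrite mul0r lexx; split=> // _.
  have [r' Cr' rr'] : exists2 r', C r' & r <= r'.
    apply: contrapT => h; apply: nub; exists r => r' Cr'.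
    by rewrite leNgt; apply/negP => /ltW rr'; apply: h; exists r'.
  exact: Cd Cr' rr'.
exists 1, (sup C) => r; rewrite mul1r; split; first exact: ub_le_sup.
move=> /(Cd _ _) h; apply: h.
have supC : has_sup C by split=> //; exists r0.
(* The supremum is itself admissible: the conditions for all [sup C - 1/(k+1)] hold simultaneously
   outside one null set. *)
have hk (k : nat) : C (sup C - k.+1%:R^-1).
  have [r' Cr' hr'] := @sup_adherent _ C k.+1%:R^-1 ltac:(by rewrite invr_gt0) supC.
  by apply: Cd Cr' _; exact: ltW.
apply: filterS (ae_foralln hk) => w h.
apply/ler_addgt0Pr => e e0.
have [k] := ltr_add_invr e0; rewrite add0r => ke.
by move: (k.+1%:R^-1) ke (h k) => dl; lra.
Qed.

(** Each row splits into a state part and a noise part, so its almost sure validity is a bound on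
    the state part; finitely many rows can be treated separately. *)
Lemma polyhedral_ae D : polyhedral D ->
  polyhedral [set z | \forall w \ae P, D (z, noise w)].
Proof.
move=> [I [a [c [ha ->]]]].
have /choice[sm hsm] : forall i, exists sm : R * R,
    forall r, (\forall w \ae P, r + a i (0, noise w) <= c i) <-> sm.1 * r <= sm.2.
  by move=> i; have [s [m sm]] := ae_le_halfline (fun w => a i (0, noise w)) (c i); exists (s, m).
rewrite (_ : mkset _ = [set z | forall i, (sm i).1 * a i (z, 0) <= (sm i).2]).
  by apply: polyhedral_le => i; apply: blin_mull; exact: blin_left.
apply/seteqP; split => z /=.
  move=> h i; apply/hsm; apply: filterS h => w /(_ i).
  by rewrite (blin_split _ _ (ha i)).
move=> h; apply: filter_forall => i; have /hsm := h i.
by apply: filterS => w; rewrite (blin_split z (noise w) (ha i)).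
Qed.

(* The value is [-oo] as soon as infeasibility has positive probability, so the
   domain of the expectation consists of the almost surely feasible states. *)
Lemma lipconc_expectation D (v : Z * 'rV[R]_n -> Q' -> R) (B : Q * R -> Q') :
  polyhedral D -> lipconc D v -> lipschitz_map B ->
  let D' := [set z | \forall w \ae P, D (z, noise w)] in
  exists v' : Z -> Q -> R,
    [/\ polyhedral D', lipconc D' v' & forall z p,
      (\int[P]_w (if `[< D (z, noise w) >] then (v (z, noise w) (B (p, eps w)))%:E else -oo) =
       if `[< D' z >] then (v' z p)%:E else -oo)%E].
Proof.
move=> pD lv lB D'.
have [K K0 [v1 v2 v3 v4]] := lv.
have [L L0 BL] := lipschitz_map_bound lB.
have [M M0 BM] := lB.
have KL0 : 0 <= K * L by exact: mulr_ge0.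
have KM0 : 0 <= K * M by exact: mulr_ge0.
(* The default 0 outside [D] keeps the integrand real; for [z] in [D'] it is taken only on a null
   set. *)
pose g z p w := if `[< D (z, noise w) >] then v (z, noise w) (B (p, eps w)) else 0.
pose V z p := \int[P]_w g z p w.
have mg z p : measurable_fun setT (g z p).
  apply: (@measurable_noise_fun [set y | D (z, y)] (fun y e => v (z, y) (B (p, e)))).
    exact: measurable_polyhedral_noise.
  move=> y e c Dy cF /=.
  (* [H] exceeds the sum of the Lipschitz constants in the inflow noise and in the price noise, so
     moving each by less than the gap divided by [H] keeps the value above [c]. *)
  pose H := K * (1 + `|B (p, e)|) + K * M + 1.
  have H0 : 0 < H by rewrite ltr_wpDl// addr_ge0// mulr_ge0// addr_ge0.
  exists ((v (z, y) (B (p, e)) - c) / H); first by rewrite divr_gt0// subr_gt0.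
  move=> y' e' Dy'; rewrite !ltr_pdivlMr// => h1 h2.
  have := v2 _ _ (B (p, e)) Dy Dy'.
  have := v3 _ (B (p, e)) (B (p, e')) Dy'.
  rewrite (_ : (z, y) - (z, y') = (0, y - y')); last by congr pair; rewrite /= subrr.
  rewrite prod_normE/= normr0 max_r//.
  have := ler_wpM2l K0 (BM (p, e) (p, e')).
  rewrite (_ : (p, e) - (p, e') = (0, e - e')); last by congr pair; rewrite /= subrr.
  rewrite prod_normE/= normr0 max_r// mulrA.
  have := normr_ge0 (y - y'); have := normr_ge0 (e - e').
  have X0 : 0 <= K * (1 + `|B (p, e)|) by rewrite mulr_ge0// addr_ge0.
  move: h1 h2; rewrite /H; move: X0 KM0.
  set X := K * (1 + _); set Y := K * M; set a := `|y - y'|; set b := `|e - e'|.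
  set t := _ - c.
  move=> *.
  have : X * a + Y * b < t; last by rewrite /t; lra.
  have [ab|ba] := leP a b; nra.
have hpe p e : 1 + `|B (p, e)| <= L * (1 + `|p| + `|e|).
  rewrite (le_trans (BL _))// ler_wpM2l// -addrA lerD2l prod_normE/= ge_max.
  by rewrite lerDl lerDr !normr_ge0.
pose m := \int[P]_w `|eps w|.
have m0 : 0 <= m by exact: Rintegral_ge0.
have ih (a b : R) : P.-integrable setT (EFin \o (fun w => a + b * `|eps w|)).
  rewrite (_ : EFin \o _ = (cst a%:E \+ (fun w => b%:E * `|eps w|%:E))%E); last first.
    by apply/funext => w /=; rewrite EFinD EFinM.
  apply: integrableD => //; first exact: finite_measure_integrable_cst.
  by apply: integrableZl => //; exact: integrable_norm.
have Ih (a b : R) : \int[P]_w (a + b * `|eps w|) = a + b * m.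
  rewrite RintegralD//; last 2 first.
  - exact: finite_measure_integrable_cst.
  - rewrite (_ : EFin \o _ = (fun w => b%:E * `|eps w|%:E)%E)//.
    by apply: integrableZl => //; exact: integrable_norm.
  rewrite Rintegral_cst// [X in fine X](_ : _ = 1%E); last exact: probability_setT.
  rewrite mulr1 RintegralZl//.
  exact: integrable_norm.
have gb z p w : `|g z p w| <= K * L * (1 + `|p|) + K * L * `|eps w|.
  rewrite /g; case: asboolP => [Dw|_].
    rewrite (le_trans (v1 _ _ Dw))// -mulrDr -mulrA ler_wpM2l//.
  by rewrite normr0 addr_ge0// mulr_ge0// addr_ge0.
have ig z p : P.-integrable setT (EFin \o g z p).
  apply: (le_integrable measurableT _ _ (ih (K * L * (1 + `|p|)) (K * L))).
    exact/measurable_EFinP.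
  move=> w _ /=; rewrite lee_fin (le_trans (gb z p w))//.
  by rewrite ler_norm.
have gE z p w : D (z, noise w) -> g z p w = v (z, noise w) (B (p, eps w)).
  by move=> Dw; rewrite /g; case: asboolP.
have mf z p : measurable_fun setT (fun w =>
    (if `[< D (z, noise w) >] then (v (z, noise w) (B (p, eps w)))%:E else -oo)%E).
  rewrite (_ : (fun w => _) = fun w =>
    (if `[< D (z, noise w) >] then (g z p w)%:E else -oo)%E); last first.
    by apply/funext => w; rewrite /g; case: asboolP.
  apply: measurable_fun_ifT => //; last exact/measurable_EFinP.
  apply: (measurable_fun_bool true); rewrite setTI.
  rewrite (_ : _ @^-1` _ = [set w | D (z, noise w)]).
    exact: measurable_polyhedral_noise.
  by apply/seteqP; split => w /asboolP.
exists V; split; first exact: polyhedral_ae.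
(* Integrating the growth bound brings in the first absolute moment [m] of [eps]; [K * M] is the
   Lipschitz constant in the price data. *)
- pose C := K * L * (1 + m) + K * M.
  have C0 : 0 <= C by rewrite addr_ge0// mulr_ge0// addr_ge0.
  have Cp p : K * L * (1 + `|p|) + K * L * m <= C * (1 + `|p : Q|).
    rewrite -mulrDr /C.
    have : 0 <= K * L * (m * `|p|) + K * M * (1 + `|p|) by rewrite !(addr_ge0, mulr_ge0).
    by nra.
  exists C => //; split=> [z p Dz|z y p Dz Dy|z p q Dz|z y p s Dz Dy s01].
  + rewrite (le_trans (le_normr_Rintegral _ (ig z p)))//.
    rewrite (le_trans _ (Cp p))// -Ih.
    by apply: le_Rintegral => //; exact: integrable_norm.
  + apply: (@le_trans _ _ (V y p + (K * L * (1 + `|p|) * `|z - y| + K * L * `|z - y| * m))).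
      rewrite -Ih /V -RintegralD//.
      apply: le_Rintegral_ae => //.
        rewrite (_ : EFin \o _ = ((EFin \o g y p) \+
          (EFin \o (fun w => (K * L * (1 + `|p|) * `|z - y| + K * L * `|z - y| * `|eps w|)%R))))%E//.
        exact: integrableD.
      apply: filterS2 Dz Dy => w Dz Dy; rewrite !gE//.
      rewrite (le_trans (v2 _ _ _ Dz Dy))// lerD2l.
      rewrite (_ : (z, noise w) - (y, noise w) = (z - y, 0)); last by congr pair; rewrite /= subrr.
      rewrite prod_normE/= normr0 max_l//.
      rewrite (mulrAC _ `|z - y| `|eps w|) -mulrDl ler_wpM2r//.
      by rewrite -mulrDr -mulrA ler_wpM2l.
    by rewrite lerD2l (mulrAC _ `|z - y| m) -mulrDl ler_wpM2r.
  + apply: (@le_trans _ _ (V z q + (C * `|p - q| + 0 * m))).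
      rewrite -Ih /V -RintegralD//.
      apply: le_Rintegral_ae => //.
        rewrite (_ : EFin \o _ = ((EFin \o g z q) \+
          (EFin \o (fun w => (C * `|p - q| + 0 * `|eps w|)%R))))%E//.
        exact: integrableD.
      apply: filterS Dz => w Dz; rewrite !gE//.
      rewrite (le_trans (v3 _ _ (B (q, eps w)) Dz))// lerD2l mul0r addr0.
      rewrite (le_trans (ler_wpM2l K0 (BM _ _)))//.
      rewrite (_ : (p, eps w) - (q, eps w) = (p - q, 0)); last by congr pair; rewrite /= subrr.
      rewrite prod_normE/= normr0 max_l// mulrA ler_wpM2r// /C lerDr.
      by rewrite mulr_ge0// addr_ge0.
    by rewrite mul0r addr0.
  + have igs t x : P.-integrable setT (EFin \o (fun w => t * g x p w)).
      rewrite (_ : EFin \o _ = (fun w => t%:E * (g x p w)%:E)%E)//.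
      by apply: integrableZl => //; exact: ig.
    rewrite /V -!RintegralZl// -RintegralD//.
    apply: le_Rintegral_ae => //.
      rewrite (_ : EFin \o _ = ((EFin \o (fun w => (s * g z p w)%R)) \+
          (EFin \o (fun w => ((1 - s) * g y p w)%R))))%E//.
      exact: integrableD.
    apply: filterS2 Dz Dy => w Dz Dy.
    have E : s *: (z, noise w) + (1 - s) *: (y, noise w) =
        (s *: z + (1 - s) *: y, noise w).
      by congr pair; rewrite /= -scalerDl subrKC scale1r.
    rewrite !gE//; last by rewrite -E; exact: (polyhedral_convex pD Dz Dy s01).
    by rewrite -E v4.
- move=> z p; case: asboolP => [Dz|nDz].
    rewrite /V /Rintegral fineK; last exact: (integrable_fin_num measurableT (ig z p)).
    apply: ae_eq_integral => //.
    + exact/measurable_EFinP.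
    + by apply: filterS Dz => w Dz _; rewrite /= gE//; case: asboolP.
  apply: (integral_ninfty _ (ih (K * L * (1 + `|p|)) (K * L))).
  + exact: mf.
  + move=> w /=; case: asboolP => [Dw|_]; last exact: leNye.
    rewrite lee_fin -gE//.
    by rewrite (le_trans (ler_norm _))// gb.
  + move=> h; apply: nDz; apply: filterS h => w.
    by case: asboolP.
Qed.

End Expectation.

(** * Supergradients of concave functions *)

Section Supergradients.
Variable R : realType.

(* Hahn-Banach, one direction at a time. *)
Lemma concave_supergradient (X : lmodType R) (W : X -> R) (I : eqType)
    (e : I -> X) (x0 : X) :
  (forall x y s, 0 <= s <= 1 ->
     s * W x + (1 - s) * W y <= W (s *: x + (1 - s) *: y)) ->
  forall r : seq I, uniq r -> exists c : I -> R, forall s : I -> R,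
    W (x0 + \sum_(i <- r) s i *: e i) <= W x0 + \sum_(i <- r) c i * s i.
Proof.
move=> cW; elim=> [_|i r IH /= /andP[ir /IH[c hc]]].
  by exists (fun=> 0) => s; rewrite !big_nil !addr0.
pose U s := \sum_(j <- r) s j *: e j.
pose C s := \sum_(j <- r) c j * s j.
(* The forward slopes in the new direction [e i], after subtraction of the linear form [C] found for
   the earlier directions. *)
pose up := [set a | exists s (h : R), 0 < h /\
  a = (W (x0 + (h *: e i + U s)) - W x0 - C s) / h].
(* No forward slope exceeds a backward slope: the weight [l = k / (h + k)] cancels the components
   along [e i], and the induction hypothesis bounds [W] at the resulting point. *)
have key s s' (h k : R) : 0 < h -> 0 < k ->
    (W (x0 + (h *: e i + U s)) - W x0 - C s) / h <=
    - (W (x0 + (- k *: e i + U s')) - W x0 - C s') / k.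
  move=> h0 k0; have hk : 0 < h + k by rewrite addr_gt0.
  pose l := k / (h + k).
  have l01 : 0 <= l <= 1.
    apply/andP; split; first by rewrite divr_ge0// ltW.
    by rewrite ler_pdivrMr// mul1r lerDr ltW.
  pose s2 j := l * s j + (1 - l) * s' j.
  have l1 : 1 - l = h / (h + k) by rewrite /l; field; rewrite gt_eqF.
  have eW : l *: (x0 + (h *: e i + U s)) + (1 - l) *: (x0 + (- k *: e i + U s')) =
      x0 + U s2.
    have -> : U s2 = l *: U s + (1 - l) *: U s'.
      rewrite /U !scaler_sumr -big_split/=; apply: eq_bigr => j _.
      by rewrite /s2 [LHS]scalerDl !scalerA.
    rewrite !scalerDr addrACA -scalerDl subrKC scale1r; congr (_ + _).
    rewrite addrACA !scalerA -scalerDl (_ : l * h + _ = 0) ?scale0r ?add0r//.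
    by rewrite l1 /l; field; rewrite gt_eqF.
  have eC : C s2 = l * C s + (1 - l) * C s'.
    rewrite /C !mulr_sumr -big_split/=; apply: eq_bigr => j _.
    by rewrite /s2; ring.
  have := cW _ _ _ l01 => /(_ (x0 + (h *: e i + U s)) (x0 + (- k *: e i + U s'))).
  rewrite eW => /le_trans/(_ (hc s2)); rewrite -/(C s2) eC l1.
  set a := W _; set b := W _; set w := W x0; set p := C s; set q := C s' => H.
  rewrite ler_pdivrMr// mulrAC ler_pdivlMr//.
  have E : h / (h + k) * (h + k) = h by rewrite divfK// gt_eqF.
  have E' : l * (h + k) = k by rewrite /l divfK// gt_eqF.
  have : (l * a + h / (h + k) * b) * (h + k) <=
         (w + (l * p + h / (h + k) * q)) * (h + k) by rewrite ler_wpM2r// ltW.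
  have -> : (l * a + h / (h + k) * b) * (h + k) = k * a + h * b.
    by rewrite mulrDl (mulrAC l) (mulrAC (h / (h + k))) E E'.
  have -> : (w + (l * p + h / (h + k) * q)) * (h + k) = w * (h + k) + (k * p + h * q).
    by rewrite mulrDl [X in _ + X]mulrDl (mulrAC l) (mulrAC (h / (h + k))) E E'.
  lra.
have up0 : up !=set0 by exists ((W (x0 + (1 *: e i + U (fun=> 0))) - W x0 - C (fun=> 0)) / 1);
  exists (fun=> 0), 1.
have ubup k s' : 0 < k -> ubound up (- (W (x0 + (- k *: e i + U s')) - W x0 - C s') / k).
  by move=> k0 _ [s [h [h0 ->]]]; exact: key.
(* Any number separating forward from backward slopes serves as the new coefficient. *)
pose kap := sup up.
exists (fun j => if j == i then kap else c j) => s.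
rewrite !big_cons eqxx.
have -> : \sum_(j <- r) (if j == i then kap else c j) * s j = C s.
  apply: eq_big_seq => j jr; case: eqP => // ji.
  by move: ir; rewrite -ji jr.
rewrite -/(U s).
have [s0|s0|s0] := ltgtP (s i) 0.
- have : kap <= - (W (x0 + (- (- s i) *: e i + U s)) - W x0 - C s) / - s i.
    by apply: ge_sup => //; apply: ubup; rewrite oppr_gt0.
  rewrite opprK ler_pdivlMr ?oppr_gt0//; lra.
- have : (W (x0 + (s i *: e i + U s)) - W x0 - C s) / s i <= kap.
    apply: ub_le_sup; last by exists s, (s i).
    by exists (- (W (x0 + (- 1 *: e i + U s)) - W x0 - C s) / 1); exact: ubup.
  rewrite ler_pdivrMr//; lra.
- by rewrite s0 scale0r add0r mulr0 add0r; exact: hc.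
Qed.

(* [W] below is the smallest concave [K]-Lipschitz majorant of [v] on the whole
   space, so supergradients exist at the boundary of [D] as well. *)
Lemma lipconc_supergradient (X Q : normedModType R) (D : set X) (v : X -> Q -> R)
    (I : finType) (e : I -> X) (x0 : X) (p : Q) :
  polyhedral D -> lipconc D v -> D x0 ->
  exists c : I -> R, forall s : I -> R, D (x0 + \sum_i s i *: e i) ->
    v (x0 + \sum_i s i *: e i) p <= v x0 p + \sum_i c i * s i.
Proof.
move=> pD [K0 K00 [_ v2 _ v4]] Dx0.
pose K := K0 * (1 + `|p|).
have K_ge0 : 0 <= K by rewrite mulr_ge0// addr_ge0.
pose S y := [set v x p - K * `|x - y| | x in D].
pose W y := sup (S y).
have tri (x y z : X) : K * `|x - z| <= K * `|x - y| + K * `|y - z|.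
  by rewrite -mulrDr ler_wpM2l// -{1}(subrK y x) -addrA ler_normD.
have ubS y : has_ubound (S y).
  exists (v x0 p + K * `|x0 - y|) => _ [x Dx <-].
  have := v2 x x0 p Dx Dx0; rewrite -/K.
  have := tri x y x0; rewrite (distrC y); lra.
have S0 y : S y !=set0 by exists (v x0 p - K * `|x0 - y|), x0.
have Wge x y : D x -> v x p - K * `|x - y| <= W y.
  by move=> Dx; apply: ub_le_sup => //; exists x.
have vW x : D x -> v x p <= W x.
  by move=> Dx; have := Wge x x Dx; rewrite subrr normr0 mulr0 subr0.
(* The Lipschitz bound on [v] is decisive here: it keeps the majorant from exceeding [v] at [x0],
   even on the boundary of [D]. *)
have W0 : W x0 <= v x0 p.
  apply: ge_sup => // _ [x Dx <-].
  by have := v2 x x0 p Dx Dx0; rewrite -/K; lra.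
have cW x y s : 0 <= s <= 1 -> s * W x + (1 - s) * W y <= W (s *: x + (1 - s) *: y).
  move=> s01; have /andP[s0 s1] := s01; have s1' : 0 <= 1 - s by rewrite subr_ge0.
  rewrite -lerBrDr; apply: mulr_sup_le => // _ [a Da <-]; rewrite lerBrDr addrC -lerBrDr.
  apply: mulr_sup_le => // _ [b Db <-]; rewrite lerBrDr addrC.
  rewrite (le_trans _ (Wge _ _ (polyhedral_convex pD Da Db s01)))//.
  have h : K * `|s *: a + (1 - s) *: b - (s *: x + (1 - s) *: y)| <=
      s * (K * `|a - x|) + (1 - s) * (K * `|b - y|).
    rewrite (mulrCA s) (mulrCA (1 - s)) -mulrDr ler_wpM2l//.
    rewrite opprD addrACA -!scalerBr (le_trans (ler_normD _ _))//.
    by rewrite !normrZ !ger0_norm.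
  have := v4 a b p s Da Db s01; lra.
have [c hc] := concave_supergradient e x0 cW (index_enum_uniq I).
exists c => s Ds; rewrite (le_trans (vW _ Ds))// (le_trans (hc s))//.
by rewrite lerD2r.
Qed.

End Supergradients.

(** * The value functions as Lipschitz concave functions on polyhedra *)

Section ValueFunction.
Variable R : realType.

Section Linearity.
Variable X : normedModType R.

Lemma blin_hist_dot t (c : nat -> R) (x : X -> 'cV[R]_t) :
  blin x -> blin (fun z => hist_dot c (x z)).
Proof.
move=> hx; apply: blin_sum => s; apply: blin_mull.
exact: (blin_comp hx (blin_entry _ _)).
Qed.

Lemma blin_arma_step t (c e : nat -> R) (x : X -> 'cV[R]_t) (y : X -> 'cV[R]_t.+1) :
  blin x -> blin y -> blin (fun z => arma_step c e (x z) (y z)).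
Proof. by move=> hx hy; apply: blin_add; exact: blin_hist_dot. Qed.

Lemma blin_snoc t m (H : X -> 'M[R]_(t, m)) (r : X -> 'rV[R]_m) :
  blin H -> blin r -> blin (fun z => snoc (H z) (r z)).
Proof.
move=> hH hr; apply: blin_mx => i j.
rewrite (_ : (fun _ => _) = fun z =>
  oapp (fun s => H z s j) (r z 0 j) (unlift ord_max i)); last first.
  by apply/funext => z; rewrite mxE.
case: (unlift _ _) => [s|] /=.
  exact: (blin_comp hH (blin_entry s j)).
exact: (blin_comp hr (blin_entry 0 j)).
Qed.

Lemma blin_row n (r : 'I_n -> X -> R) : (forall j, blin (r j)) ->
  blin (fun z => \row_j r j z).
Proof.
move=> hr; apply: blin_mx => i j.
rewrite (_ : (fun _ => _) = r j) //; by apply/funext => z; rewrite mxE.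
Qed.

Lemma blin_scalar_mx (r : X -> R) : blin r -> blin (fun z => (r z)%:M : 'M[R]_1).
Proof.
move=> hr; apply: blin_mx => i j.
rewrite (_ : (fun _ => _) = r) //; apply/funext => z.
by rewrite mxE !ord1 mulr1n.
Qed.

Lemma blin_col t n (H : X -> 'M[R]_(t, n)) j : blin H -> blin (fun z => col j (H z)).
Proof.
move=> hH; apply: blin_mx => i k.
rewrite (_ : (fun _ => _) = fun z => H z i j); last by apply/funext => z; rewrite mxE.
exact: (blin_comp hH (blin_entry i j)).
Qed.

Lemma blin_current t n (H : X -> 'M[R]_(t, n)) : blin H -> blin (fun z => current (H z)).
Proof.
case: t H => [|t] H hH; first exact: blin_cst0.
apply: blin_mx => i k.
rewrite (_ : (fun _ => _) = fun z => H z ord_max i).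
  exact: (blin_comp hH (blin_entry _ _)).
by apply/funext => z; rewrite !mxE.
Qed.

Lemma blin_mulmx m n (A : 'M[R]_(m, n)) (x : X -> 'cV[R]_n) :
  blin x -> blin (fun z => A *m x z).
Proof.
move=> hx; apply: blin_mx => i j.
rewrite (_ : (fun _ => _) = fun z => \sum_k A i k * x z k j).
  apply: blin_sum => k; apply: blin_mull; exact: (blin_comp hx (blin_entry _ _)).
by apply/funext => z; rewrite mxE.
Qed.

Lemma polyhedral_vec_le n (x : X -> 'cV[R]_n) (lo hi : 'cV[R]_n) :
  blin x -> polyhedral [set z | vec_le lo (x z) /\ vec_le (x z) hi].
Proof.
move=> hx; apply: (@polyhedralI _ _ [set z | vec_le lo (x z)] [set z | vec_le (x z) hi]).
  apply: (@polyhedral_ge _ _ _ (fun j z => x z j 0)) => j.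
  exact: (blin_comp hx (blin_entry _ _)).
apply: (@polyhedral_le _ _ _ (fun j z => x z j 0)) => j.
exact: (blin_comp hx (blin_entry _ _)).
Qed.

End Linearity.

Lemma vec_le_norm n (lo u hi : 'cV[R]_n) :
  vec_le lo u -> vec_le u hi -> `|u| <= `|lo| + `|hi|.
Proof.
move=> h1 h2; apply: mx_norm_le => [|i j]; first exact: addr_ge0.
rewrite ord1; have := h1 i; have := h2 i.
have := mx_norm_entry lo i 0; have := mx_norm_entry hi i 0.
by rewrite !ler_norml; lra.
Qed.

Context d (Omega : measurableType d) (P : probability Omega R).
Context (n : nat) (M : hydro_system R n) (T : nat).
Context (eps : nat -> {RV P >-> R}) (xi : 'I_n -> nat -> {RV P >-> R}).
Hypothesis heps : forall t, (0 < t <= T.+1)%N -> P.-integrable setT (EFin \o eps t).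

Lemma blin_G (X : normedModType R) (x : X -> 'cV[R]_n) :
  blin x -> blin (fun z => G M (x z)).
Proof.
move=> hx; exact: (blin_comp (blin_mulmx (rate M)^T hx) (blin_entry _ _)).
Qed.

(** Discharges and end-of-period levels lie in boxes; this supplies the bounded linear factor in
    [lipconc_bilin]. *)
Lemma G_bounded (lo hi : 'cV[R]_n) : exists C : R, forall u,
  vec_le lo u -> vec_le u hi -> `|G M u| <= C.
Proof.
have [_ [K K0 GK]] := blin_G (@blin_id R 'cV[R]_n).
exists (K * (`|lo| + `|hi|)) => u h1 h2.
by rewrite (le_trans (GK u))// ler_wpM2l// vec_le_norm.
Qed.

(** The next price is jointly linear in past prices, past noises and the new noise, so averaging
    replaces the new noise by its mean and adds a constant. *)
Lemma lipschitz_expected_price t : (t.+1 <= T.+1)%N ->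
  lipschitz_map (fun p : 'cV[R]_t * 'cV[R]_t => expected_price M eps p.1 p.2).
Proof.
move=> tT; have ie : P.-integrable setT (EFin \o eps t.+1) by exact: heps.
pose A (q : 'cV[R]_t * 'cV[R]_t * R) :=
  arma_step (theta M) (Defs.eta M) q.1.1 (snoc q.1.2 q.2%:M).
have hA : blin A.
  apply: blin_arma_step; first exact: blin_comp (blin_fst _ _) (blin_fst _ _).
  apply: blin_snoc; first exact: blin_comp (blin_fst _ _) (blin_snd _ _).
  apply: blin_scalar_mx; exact: blin_snd.
pose m := \int[P]_w eps t.+1 w.
have E p : expected_price M eps p.1 p.2 = A (p, 0) + A (0, 1) * m.
  transitivity (\int[P]_w (A (p, 0) + A (0, 1) * eps t.+1 w)).
    rewrite /expected_price unlock /Rintegral; congr fine.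
    apply: eq_integral => w _; congr EFin.
    rewrite -[LHS]/(A (p.1, p.2, eps t.+1 w)) -surjective_pairing.
    rewrite mulrC -[_ * A _]/(eps t.+1 w *: (A (0, 1) : R^o)).
    rewrite -(blinZ hA) -(blinD hA); congr A.
    by congr pair; rewrite /= ?scaler0 ?addr0// add0r [RHS]mulr1.
  rewrite RintegralD//; last 2 first.
  - exact: finite_measure_integrable_cst.
  - rewrite (_ : EFin \o _ = (fun w => (A (0, 1))%:E * (eps t.+1 w)%:E)%E)//.
    by apply: integrableZl => //.
  rewrite Rintegral_cst// [X in fine X](_ : _ = 1%E); last exact: probability_setT.
  by rewrite mulr1 RintegralZl.
have [L L0 AL] := blin_lip hA.
exists L => // p q; rewrite !E opprD addrACA subrr addr0 (le_trans (AL _ _))//.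
rewrite (_ : (p, 0) - (q, 0) = (p - q, 0)); last by congr pair; rewrite /= subrr.
by rewrite prod_normE/= normr0 max_l.
Qed.

(* The state is (lbar_t, nu_[t], xi_[t]), the parameter is (rho_[t], eps_[t]). *)
Notation state t := ('cV[R]_n * 'M[R]_(t, n) * 'M[R]_(t, n))%type.
Notation param t := ('cV[R]_t * 'cV[R]_t)%type.

(** Inflow noises belong to the state because they affect feasibility through later inflows; price
    data are parameters because they only enter the profit. Each induction step adds profit and
    future value, maximizes with [lipconc_sup] and averages with [lipconc_expectation]. *)
Lemma value_rec_lipconc k t : (t + k)%N = T ->
  exists (D : set (state t)) (v : state t -> param t -> R),
    [/\ polyhedral D, lipconc D v & forall l nu rho xh eh,
      value_rec M T eps xi k l nu rho xh eh =
      if `[< D (l, nu, xh) >] then (v (l, nu, xh) (rho, eh))%:E else -oo%E].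
Proof.
elim: k t => [|k IH] t tkT.
  exists setT, (fun _ _ => 0); split; [exact: polyhedralT|exact: lipconc0|].
  by move=> *; case: asboolP => // -[].
have [D1 [v1 [pD1 lv1 V1]]] := IH t.+1 ltac:(by rewrite addSnnS).
(* A point of [X] is a state, the next inflow noise and a discharge. The levels and inflows of the
   stage depend linearly on it, so the constraints are polyhedral in [X]. *)
pose X := (state t * 'rV[R]_n * 'cV[R]_n)%type.
pose xh' (x : X) := snoc x.1.1.2 x.1.2.
pose nu' (x : X) := snoc x.1.1.1.2
  (\row_j arma_step (psi M j) (phi M j) (col j x.1.1.1.2) (col j (xh' x))).
pose l' (x : X) := x.1.1.1.1 + current x.1.1.1.2.
pose lbar' (x : X) := l' x + routing M *m x.2.
pose next (x : X) : state t.+1 := (lbar' x, nu' x, xh' x).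
have b1 : blin (fun x : X => x.1) := blin_fst _ _.
have b11 : blin (fun x : X => x.1.1) := blin_comp b1 (blin_fst _ _).
have b12 : blin (fun x : X => x.1.2) := blin_comp b1 (blin_snd _ _).
have b111 : blin (fun x : X => x.1.1.1) := blin_comp b11 (blin_fst _ _).
have b112 : blin (fun x : X => x.1.1.2) := blin_comp b11 (blin_snd _ _).
have b1111 : blin (fun x : X => x.1.1.1.1) := blin_comp b111 (blin_fst _ _).
have b1112 : blin (fun x : X => x.1.1.1.2) := blin_comp b111 (blin_snd _ _).
have b2 : blin (fun x : X => x.2) := blin_snd _ _.
have bxh : blin xh' by exact: blin_snoc.
have bnu : blin nu'.
  apply: blin_snoc => //; apply: blin_row => j.
  by apply: blin_arma_step; exact: blin_col.
have bl : blin l' by apply: blin_add => //; exact: blin_current.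
have blb : blin lbar' by apply: blin_add => //; exact: blin_mulmx.
have bn : blin next by apply: blin_pair => //; exact: blin_pair.
pose lend (x : X) := lbar' x + current (nu' x).
have ble : blin lend by apply: blin_add => //; exact: blin_current.
pose F : set X := [set x | vec_le (lvl_min M) (lend x) /\ vec_le (lend x) (lvl_max M)]
  `&` [set x | vec_le (dis_min M) x.2 /\ vec_le x.2 (dis_max M)].
have pF : polyhedral F by apply: polyhedralI; exact: polyhedral_vec_le.
(* The terminal term gets coefficient 0 before the last period, so that both summands have the form
   treated by [lipconc_bilin]. *)
pose c (x : X) (p : param t.+1) : R := current p.1 0 0 * G M x.2 +
  (if t.+1 == T then expected_price M eps p.1 p.2 else 0) * G M (lend x).
have lc : lipconc F c.
  rewrite -[F]setIid; apply: lipconc_add.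
    have [C hC] := G_bounded (dis_min M) (dis_max M).
    apply: (lipconc_bilin (C := C)).
    - apply: blin_lip.
      apply: (blin_comp _ (blin_entry 0 0)); apply: blin_current; exact: blin_fst.
    - exact: blin_G.
    - by move=> x [_ [h1 h2]]; exact: hC.
  have [C hC] := G_bounded (lvl_min M) (lvl_max M).
  apply: (lipconc_bilin (C := C)).
  - case: eqP => [tT|_]; first by apply: lipschitz_expected_price; rewrite tT.
    exact: blin_lip (blin_cst0 _ _).
  - exact: blin_G.
  - by move=> x [[h1 h2] _]; exact: hC.
pose D2 := F `&` next @^-1` D1.
have pD2 : polyhedral D2 by apply: polyhedralI => //; exact: polyhedral_preimage.
have lw := lipconc_add lc (lipconc_preimage bn lv1).
have [pD3 lv3] := lipconc_sup pD2 lw.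
pose B (q : param t * R) : param t.+1 :=
  let eh' := snoc q.1.2 q.2%:M in
  (snoc q.1.1 (arma_step (theta M) (Defs.eta M) q.1.1 eh')%:M, eh').
have lB : lipschitz_map B.
  apply: blin_lip.
  have q1 : blin (fun q : param t * R => q.1.1) := blin_comp (blin_fst _ _) (blin_fst _ _).
  have q2 : blin (fun q : param t * R => q.1.2) := blin_comp (blin_fst _ _) (blin_snd _ _).
  have qe : blin (fun q : param t * R => snoc q.1.2 q.2%:M).
    by apply: blin_snoc => //; apply: blin_scalar_mx; exact: blin_snd.
  apply: blin_pair => //; apply: blin_snoc => //; apply: blin_scalar_mx.
  exact: blin_arma_step.
have mxi j : measurable_fun setT (xi j t.+1) by exact: measurable_funP.
have ie : P.-integrable setT (EFin \o eps t.+1).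
  by apply: heps; rewrite -tkT /= addnS !ltnS leqW// leq_addr.
have [v4 [pD4 lv4 V4]] := lipconc_expectation mxi ie pD3 lv3 lB.
exists [set z | \forall w \ae P, [set x | exists u, D2 (x, u)] (z, noise (fun j => xi j t.+1) w)], v4.
split=> // l nu rho xh eh; rewrite -V4 /=.
apply: eq_integral => w _.
pose x pi : X := ((l, nu, xh), noise (fun j => xi j t.+1) w, pi).
set p := B _.
(* The starting level, the inflows and the noise histories do not involve the discharge, so [x 0]
   evaluates them at a dummy discharge. *)
have feasE pi : feasible M (l' (x 0)) (current (nu' (x 0))) pi <-> F (x pi).
  split=> [[h1 h2 h3 h4]|[[h1 h2] [h3 h4]]]; first by split; split.
  by split.
have profE pi : profit M T eps pi (l' (x 0)) (nu' (x 0)) p.1 p.2 = c (x pi) p.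
  by rewrite /profit /c; case: ifP => _; rewrite ?mul0r.
have valE pi : value_rec M T eps xi k (l' (x 0) + routing M *m pi) (nu' (x 0)) p.1 (xh' (x 0)) p.2 =
    if `[< D1 (next (x pi)) >] then (v1 (next (x pi)) p)%:E else -oo%E.
  by rewrite V1.
transitivity (ereal_sup [set ((profit M T eps pi (l' (x 0%R)) (nu' (x 0%R)) p.1 p.2)%:E +
   value_rec M T eps xi k (l' (x 0%R) + routing M *m pi)%R (nu' (x 0%R)) p.1 (xh' (x 0%R)) p.2)%E
   | pi in feasible M (l' (x 0%R)) (current (nu' (x 0%R)))]); first by [].
pose S := [set c (x u) p + v1 (next (x u)) p | u in [set u | D2 (x u)]].
(* Discharges leading outside [D1] contribute [-oo]. The supremum over the remaining ones is real if
   there are any and [-oo] otherwise. *)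
case: asboolP => [[u0 Du0]|noD].
  rewrite -[X in _ = X%:E]/(sup S).
  have S0 : S !=set0 by exists (c (x u0) p + v1 (next (x u0)) p), u0.
  have ubS : has_ubound S.
    case: lw => K K0 [w1 _ _ _]; exists (K * (1 + `|p|)) => _ [u Du <-].
    by rewrite (le_trans (ler_norm _))// w1.
  rewrite -(ereal_sup_EFin ubS S0); apply/eqP; rewrite eq_le; apply/andP; split.
    apply: ge_ereal_sup => _ [pi /feasE Fpi <-]; rewrite profE valE.
    case: asboolP => [Dpi|_]; last by rewrite addeNy leNye.
    by apply: ereal_sup_ubound; exists (c (x pi) p + v1 (next (x pi)) p) => //; exists pi.
  apply: ge_ereal_sup => _ [_ [u [Fu Du] <-] <-].
  apply: ereal_sup_ubound; exists u; first exact/feasE.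
  by rewrite profE valE; case: asboolP.
apply/eqP; rewrite -leeNy_eq; apply: ge_ereal_sup => _ [pi /feasE Fpi <-].
rewrite profE valE; case: asboolP => [Dpi|_]; last by rewrite addeNy.
by case: noD; exists pi.
Qed.

End ValueFunction.

(** * The supporting hyperplane of the post-decision value function *)

Lemma hyperplane_slope (R : realType) n t (a l l0 : 'cV[R]_n) (b nu nu0 : 'M[R]_(t, n)) :
  (a^T *m (l - l0)) 0 0 + \tr (b^T *m (nu - nu0)) =
  \sum_j a j 0 * (l j 0 - l0 j 0) + \sum_s \sum_j b s j * (nu s j - nu0 s j).
Proof.
congr (_ + _); first by rewrite mxE; apply: eq_bigr => j _; rewrite !mxE.
rewrite /mxtrace exchange_big; apply: eq_bigr => j _.
by rewrite mxE; apply: eq_bigr => s _; rewrite !mxE.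
Qed.

Theorem mainTheorem2 (R : realType) (d : measure_display)
    (Omega : measurableType d) (P : probability Omega R)
    (n : nat) (M : hydro_system R n) (T : nat)
    (eps : nat -> {RV P >-> R}) (xi : 'I_n -> nat -> {RV P >-> R})
    (hcascade : cascade M)
    (heps : iid_upto T.+1 eps)
    (hxi : forall j, iid_upto T (xi j))
    (heps_int : forall t, (0 < t <= T.+1)%N ->
       P.-integrable setT (EFin \o eps t))
    (t : nat) (ht : (0 < t <= T)%N)
    (xh : 'M[R]_(t, n)) (eh : 'cV[R]_t) (rho : 'cV[R]_t)
    (l0 : 'cV[R]_n) (nu0 : 'M[R]_(t, n))
    (hfin : post_value M T eps xi l0 nu0 rho xh eh \is a fin_num) :
  exists (a : 'cV[R]_n) (b : 'M[R]_(t, n)),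
    [/\ is_supergradient
          (fun l nu => post_value M T eps xi l nu rho xh eh) l0 nu0 a b,
        forall l nu,
          (post_value M T eps xi l nu rho xh eh <=
           hyperplane M T eps xi xh eh l0 nu0 a b l nu rho)%E &
        hyperplane M T eps xi xh eh l0 nu0 a b l0 nu0 rho =
        post_value M T eps xi l0 nu0 rho xh eh].
Proof.
have /andP[_ tT] := ht.
have [D [v [pD lv V]]] := value_rec_lipconc M xi heps_int (subnKC tT).
(* The value is [-oo] outside [D], so finiteness at the base point places it in [D]. *)
have D0 : D (l0, nu0, xh).
  by move: hfin; rewrite /post_value V; case: asboolP.
pose iota1 (l : 'cV[R]_n) : 'cV[R]_n * 'M[R]_(t, n) * 'M[R]_(t, n) := (l, 0, 0).
pose iota2 (nu : 'M[R]_(t, n)) : 'cV[R]_n * 'M[R]_(t, n) * 'M[R]_(t, n) := (0, nu, 0).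
have h1 : blin iota1.
  by do 2 (apply: blin_pair; last exact: blin_cst0); exact: blin_id.
have h2 : blin iota2.
  apply: blin_pair; last exact: blin_cst0.
  by apply: blin_pair; [exact: blin_cst0|exact: blin_id].
(* The directions are the coordinates of the level and of the inflow history; the noise component
   stays fixed at [xh]. *)
pose e (i : 'I_n + 'I_t * 'I_n) := match i with
  | inl j => iota1 (delta_mx j 0)
  | inr sj => iota2 (delta_mx sj.1 sj.2) end.
have [c hc] := lipconc_supergradient e (rho, eh) pD lv D0.
pose a : 'cV[R]_n := \col_j c (inl j).
pose b : 'M[R]_(t, n) := \matrix_(s, j) c (inr (s, j)).
have supg : is_supergradient
    (fun l nu => post_value M T eps xi l nu rho xh eh) l0 nu0 a b.
  move=> l nu; rewrite /post_value !V.
  case: (asboolP (D (l0, nu0, xh))) => // _.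
  case: asboolP => [Dl|_]; last exact: leNye.
  rewrite -EFinD lee_fin.
  pose s (i : 'I_n + 'I_t * 'I_n) := match i with
    | inl j => (l - l0) j 0
    | inr sj => (nu - nu0) sj.1 sj.2 end.
  have es : (l0, nu0, xh) + \sum_i s i *: e i = (l, nu, xh).
    rewrite big_sumType/=.
    have -> : \sum_j (l - l0) j 0 *: iota1 (delta_mx j 0) = iota1 (l - l0).
      rewrite [in RHS](matrix_sum_delta (l - l0)) blin_sumE//; apply: eq_bigr => j _.
      by rewrite big_ord1 (blinZ h1).
    have -> : \sum_sj (nu - nu0) sj.1 sj.2 *: iota2 (delta_mx sj.1 sj.2) = iota2 (nu - nu0).
      rewrite [in RHS](matrix_sum_delta (nu - nu0)) pair_bigA blin_sumE//.
      by apply: eq_bigr => sj _; rewrite (blinZ h2).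
    by congr (_, _, _); rewrite /= ?addr0 ?add0r ?subrKC.
  have := hc s; rewrite es => /(_ Dl) /le_trans; apply; rewrite lerD2l.
  rewrite big_sumType/= le_eqVlt; apply/orP; left; apply/eqP; congr (_ + _).
    by apply: eq_bigr => j _; rewrite !mxE.
  rewrite pair_bigA/=; apply: eq_bigr => -[i j] _ /=.
  by rewrite !mxE.
exists a, b; split=> //.
  by move=> l nu; rewrite /hyperplane hyperplane_slope; exact: supg.
by rewrite /hyperplane !subrr !mulmx0 mxtrace0 mxE addr0 adde0.
Qed.
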